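(* Let $f,g,A,\mathcal Z,x^0,z^0$ satisfy the Assumption stated in the context, and assume in addition that $f$ is convex. Let $\epsilon>0$, $\kappa>\kappa_y>1$, $\gamma\in(0,1)$, $\eta\in(0,1)$, and let the initial values $\beta_y>0$, $\beta>0$ be arbitrary. Assume that new constraints are never detected, so that the practical BC-ADMM algorithm takes the form given in the context. Then the algorithm converges to an $\epsilon$-stationary solution of $\min_{x,\,z\in\mathcal Z} f(x)+g(Ax,z)$; that is, after finitely many iterations it reaches its termination test and returns a triple $(x,y,z)$ that is an $\epsilon$-stationary solution in the sense of the context.
   Context: Notation. $\mathbb R^+=[0,\infty)$; extended-real functions are continuous as maps into $[0,\infty]$; $\mathrm{dom}(h)=\{h<\infty\}$; $A\in\mathbb R^{m\times n}$; $\mathcal Z\subseteq\mathbb R^l$; $\iota_{\mathcal Z}$ is the indicator function ($0$ on $\mathcal Z$, $\infty$ elsewhere). A function is coercive if it tends to $\infty$ as the norm of its argument tends to $\infty$. For $r,M>0$ let $$\mathcal S_{\mathcal Z}(r,M)=\{(y,z)\in\mathbb R^{m}\times\mathbb R^{l}: g(y,z)\le M,\ \|(y,z)\|\le r,\ z\in\mathcal Z\}.$$ Assumption. i) $f:\mathbb R^n\to\mathbb R^+\cup\{\infty\}$ is continuous, and differentiable in $\mathrm{dom}(f)$; $g:\mathbb R^{m+l}\to\mathbb R^+\cup\{\infty\}$ is continuous, and twice continuously differentiable in $\mathrm{dom}(g)$. ii) $(x,z)\mapsto f(x)+g(Ax,z)$ is coercive. iii) A strictly feasible $x^0\in\mathbb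 R^n$, $z^0\in\mathcal Z$ is given, i.e. $f(x^0)+g(Ax^0,z^0)<\infty$. iv) $g(\cdot,z)$ is convex for every $z$. vi) $\mathcal Z$ is closed. For all $r,M>0$: whenever $(y,z)\in\mathcal S_{\mathcal Z}(r,M)$, the function $g(y,\cdot)+\iota_{\mathcal Z}(\cdot)$ has a unique global minimizer, denoted $z(y)$, and $(y,z(y))\in\mathcal S_{\mathcal Z}(\bar r_{zy}^{r,M},M)$ for some finite constant $\bar r_{zy}^{r,M}$ depending only on $r,M$. Further, on the set of $y$ with $(y,z(y))\in\mathcal S_{\mathcal Z}(r,M)$, the map $y\mapsto z(y)$ is $L_{zy}^{r,M}$-Lipschitz continuous for some finite $L_{zy}^{r,M}$. Augmented Lagrangian: $\mathcal L(x,y,z,\lambda)=f(x)+g(y,z)+\frac{\beta}{2}\|Ax-y\|^2+\lambda^T(Ax-y)$. Practical BC-ADMM (no constraint ever detected). Initialize $\epsilon_x=\beta_y\gamma/(\beta_y+\beta\gamma)$, $\beta_x=\beta(1/\epsilon_x-1)\|A^TA\|/\gamma$, $y^0=Ax^0$, $z^0=z(y^0)$, $\lambda^0=\nabla_y g(y^0,z^0)$, best solution $(x^\star,z^\star)=(x^0,z^0)$, $K=1$. For $k=0,1,2,\dots$: 1. $x^{k+1}=\operatorname{argmin}_x \mathcal L(x,y^k,z^k,\lambda^k)+\frac{\beta_x}{2}\|x-x^k\|^2$; then $y^{k+1}=\operatorname{argmin}_y\mathcal L(x^{k+1},y,z^k,\lambda^k)+\frac{\beta_y}{2}\|y-y^k\|^2$;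 then $z^{k+1}=\operatorname{argmin}_{z\in\mathcal Z}\mathcal L(x^{k+1},y^{k+1},z,\lambda^k)=z(y^{k+1})$. 2. Termination test: if $\max\{\|\nabla f(x^{k+1})+A^T\nabla_y g(y^{k+1},z^{k+1})\|_\infty,\ \|Ax^{k+1}-y^{k+1}\|_\infty\}\le\epsilon$, return $(x^{k+1},y^{k+1},z^{k+1})$. 3. Set $\Theta^{k+1}=\max\{\|\nabla f(x^{k+1})+A^T\nabla_y g(y^{k+1},z^{k})\|_\infty,\ \|Ax^{k+1}-y^{k+1}\|_\infty\}$ and $\Lambda^{k+1}=f(x^\star)+g(Ax^\star,z^\star)+(1-\eta)\big(g(y^{k+1},z^{k+1})-g(y^{k+1},z^\star)\big)$. 4. Lazy update: if $f(x^{k+1})+g(Ax^{k+1},z^{k+1})<\Lambda^{k+1}$ and $\Theta^{k+1}\le\eta^K$, set $(x^\star,z^\star)\leftarrow(x^{k+1},z^{k+1})$ and $K\leftarrow K+1$; otherwise reset $z^{k+1}\leftarrow z^k$. 5. $\lambda^{k+1}=\lambda^k+\beta(Ax^{k+1}-y^{k+1})$. 6. Feasibility safeguard: if $f(x^{k+1})+g(Ax^{k+1},z^{k+1})=\infty$, set $(x^{k+1},z^{k+1})\leftarrow(x^\star,z^\star)$, $y^{k+1}\leftarrow Ax^{k+1}$, $\lambda^{k+1}\leftarrow\nabla_y g(y^{k+1},z^{k+1})$, $\beta_y\leftarrow\kappa_y\beta_y$, $\beta\leftarrow\kappa\beta$, and recompute $\epsilon_x=\beta_y\gamma/(\beta_y+\beta\gamma)$,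 $\beta_x=\beta(1/\epsilon_x-1)\|A^TA\|/\gamma$. $\epsilon$-stationarity here: a triple $(x,y,z)$ with $z\in\mathcal Z$ is $\epsilon$-stationary if $\|\nabla f(x)+A^T\nabla_y g(y,z)\|_\infty\le\epsilon$, $\|Ax-y\|_\infty\le\epsilon$, and $\mathrm{dist}(N_{\mathcal Z}(z),-\nabla_z g(y,z))\le\epsilon$, where $N_{\mathcal Z}$ is the (limiting) normal cone. *)

(* Defs.v *)
From HB Require Import structures.
From mathcomp Require Import all_boot all_order all_algebra.
From mathcomp Require Import all_classical all_reals all_analysis.

Set Implicit Arguments.
Unset Strict Implicit.
Unset Printing Implicit Defensive.

Import Order.TTheory GRing.Theory Num.Theory.
Import numFieldNormedType.Exports.

Local Open Scope classical_set_scope.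
Local Open Scope ring_scope.

(* The library's norm `|v| on 'cV[R]_p is the sup norm and is used below for
   the infinity norm; the Euclidean norm is [enorm]. *)
Section Euclidean.
Context {R : realType}.

Definition dotv p (u v : 'cV[R]_p) : R := (u^T *m v) 0 0.

Definition enorm p (v : 'cV[R]_p) : R := Num.sqrt (\sum_i v i 0 ^+ 2).

(* spectral norm *)
Definition opnorm p q (M : 'M[R]_(p, q)) : R :=
  sup [set enorm (M *m v) | v in [set v : 'cV[R]_q | enorm v <= 1]].

End Euclidean.

Section Calculus.
Context {R : realType}.

Definition grad p (h : 'cV[R]_p -> R) (x : 'cV[R]_p) : 'cV[R]_p :=
  \col_i 'D_(delta_mx i 0) h x.

Definition hess p (h : 'cV[R]_p -> R) (x : 'cV[R]_p) : 'M[R]_p :=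
  \matrix_(i, j) 'D_(delta_mx j 0) (fun w => 'D_(delta_mx i 0) h w) x.

Definition edom p (h : 'cV[R]_p -> \bar R) : set 'cV[R]_p :=
  [set x | (h x < +oo)%E].

(* In the next two definitions h >= 0 is continuous into the extended reals, so
   edom h is open and near its points h agrees with the real-valued function
   fine \o h (whose value outside edom h is the irrelevant fine +oo = 0). *)
Definition differentiable_in_dom p (h : 'cV[R]_p -> \bar R) : Prop :=
  forall x, edom h x -> differentiable (fine \o h) x.

Definition C2_in_dom p (h : 'cV[R]_p -> \bar R) : Prop :=
  forall x, edom h x ->
    [/\ differentiable (fine \o h) x,
        differentiable (grad (fine \o h)) x &
        {for x, continuous (hess (fine \o h))}].

Definition econvex p (h : 'cV[R]_p -> \bar R) : Prop :=
  forall (t : R) (u v : 'cV[R]_p), 0 <= t <= 1 ->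
    (h (t *: u + (1 - t) *: v)%R <= t%:E * h u + (1 - t)%R%:E * h v)%E.

Definition coercive p (h : 'cV[R]_p -> \bar R) : Prop :=
  forall M : R, exists r : R, forall v, r <= enorm v -> (M%:E <= h v)%E.

Definition is_argmin (T : Type) (D : set T) (F : T -> \bar R) (a : T) : Prop :=
  D a /\ forall b, D b -> (F a <= F b)%E.

Definition iota_set p (Z : set 'cV[R]_p) (z : 'cV[R]_p) : \bar R :=
  if z \in Z then 0%E else +oo%E.

(* regular (Frechet) and limiting (Mordukhovich) normal cones *)
Definition regular_normal p (Z : set 'cV[R]_p) (z : 'cV[R]_p) : set 'cV[R]_p :=
  [set v | Z z /\ forall e : R, 0 < e -> exists2 d : R, 0 < d &
     forall w, Z w -> enorm (w - z) <= d ->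
       dotv v (w - z) <= e * enorm (w - z)].

Definition limiting_normal p (Z : set 'cV[R]_p) (z : 'cV[R]_p)
    : set 'cV[R]_p :=
  [set v | Z z /\ exists zk vk : nat -> 'cV[R]_p,
     [/\ forall k, regular_normal Z (zk k) (vk k),
         zk @ \oo --> z & vk @ \oo --> v]].

(* extended-real valued, so that the distance to the empty set is +oo *)
Definition edist p (S : set 'cV[R]_p) (v : 'cV[R]_p) : \bar R :=
  ereal_inf [set (enorm (v - w))%:E | w in S].

End Calculus.

Section Problem.
Context {R : realType} {n m l : nat}.
Context (f : 'cV[R]_n -> \bar R) (g : 'cV[R]_(m + l) -> \bar R).
Context (A : 'M[R]_(m, n)) (Z : set 'cV[R]_l).

Definition grad_y (y : 'cV[R]_m) (z : 'cV[R]_l) : 'cV[R]_m :=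
  grad (fun u => fine (g (col_mx u z))) y.

Definition grad_z (y : 'cV[R]_m) (z : 'cV[R]_l) : 'cV[R]_l :=
  grad (fun w => fine (g (col_mx y w))) z.

Definition grad_f (x : 'cV[R]_n) : 'cV[R]_n := grad (fine \o f) x.

Definition objective (x : 'cV[R]_n) (z : 'cV[R]_l) : \bar R :=
  (f x + g (col_mx (A *m x) z))%E.

Definition level (r M : R) (y : 'cV[R]_m) (z : 'cV[R]_l) : Prop :=
  [/\ (g (col_mx y z) <= M%:E)%E, enorm (col_mx y z) <= r & Z z].

Definition z_minimizer (y : 'cV[R]_m) (z : 'cV[R]_l) : Prop :=
  is_argmin setT (fun w => (g (col_mx y w) + iota_set Z w)%E) z.

(* z(y); meaningful when the minimizer exists and is unique *)
Definition zsol (y : 'cV[R]_m) : 'cV[R]_l := xget 0 (z_minimizer y).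

Definition z_subproblem_regular (r M : R) : Prop :=
  exists rbar L : R,
    (forall y z, level r M y z ->
       (exists! w, z_minimizer y w) /\ level rbar M y (zsol y)) /\
    (forall y1 y2, level r M y1 (zsol y1) -> level r M y2 (zsol y2) ->
       enorm (zsol y1 - zsol y2) <= L * enorm (y1 - y2)).

Record standing_assumption (x0 : 'cV[R]_n) (z0 : 'cV[R]_l) : Prop := {
  f_ge0 : forall x, (0 <= f x)%E ;
  f_cont : continuous f ;
  f_diff : differentiable_in_dom f ;
  g_ge0 : forall p, (0 <= g p)%E ;
  g_cont : continuous g ;
  g_C2 : C2_in_dom g ;
  obj_coercive :
    coercive (fun v : 'cV[R]_(n + l) => objective (usubmx v) (dsubmx v)) ;
  z0_in : Z z0 ;
  start_feasible : (objective x0 z0 < +oo)%E ;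
  g_convex : forall z, econvex (fun y => g (col_mx y z)) ;
  Z_closed : closed Z ;
  z_regular : forall r M : R, 0 < r -> 0 < M -> z_subproblem_regular r M
}.

Definition aug_lagrangian (beta : R) (x : 'cV[R]_n) (y : 'cV[R]_m)
    (z : 'cV[R]_l) (lam : 'cV[R]_m) : \bar R :=
  (f x + g (col_mx y z) +
   (beta / 2 * enorm (A *m x - y) ^+ 2 + dotv lam (A *m x - y))%R%:E)%E.

(* The first two conditions make the gradients meaningful. *)
Definition eps_stationary (eps : R) (x : 'cV[R]_n) (y : 'cV[R]_m)
    (z : 'cV[R]_l) : Prop :=
  [/\ edom f x /\ edom g (col_mx y z),
      Z z,
      `|grad_f x + A^T *m grad_y y z| <= eps,
      `|A *m x - y| <= eps &
      (edist (limiting_normal Z z) (- grad_z y z)%R <= eps%:E)%E].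

End Problem.

(* Data carried from one iteration to the next: the iterate, the best solution
   (st_xbest, st_zbest), the counter K and the current values of beta_y, beta;
   epsilon_x and beta_x are always the functions of beta_y, beta below. *)
Record state (R : realType) (n m l : nat) := State {
  st_x : 'cV[R]_n ;
  st_y : 'cV[R]_m ;
  st_z : 'cV[R]_l ;
  st_lam : 'cV[R]_m ;
  st_xbest : 'cV[R]_n ;
  st_zbest : 'cV[R]_l ;
  st_K : nat ;
  st_betay : R ;
  st_beta : R
}.

Inductive outcome (R : realType) (n m l : nat) :=
| Return of 'cV[R]_n & 'cV[R]_m & 'cV[R]_l
| Continue of state R n m l.

Section Algorithm.
Context {R : realType} {n m l : nat}.
Context (f : 'cV[R]_n -> \bar R) (g : 'cV[R]_(m + l) -> \bar R).
Context (A : 'M[R]_(m, n)) (Z : set 'cV[R]_l).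
Context (eps kappa kappay gamma eta : R).

Definition eps_x (betay beta : R) : R :=
  betay * gamma / (betay + beta * gamma).

Definition beta_x (betay beta : R) : R :=
  beta * ((eps_x betay beta)^-1 - 1) * opnorm (A^T *m A) / gamma.

Definition bcadmm_init (x0 : 'cV[R]_n) (betay beta : R) : state R n m l :=
  let y0 := A *m x0 in
  let z0 := zsol g Z y0 in
  State x0 y0 z0 (grad_y g y0 z0) x0 z0 1 betay beta.

Definition subproblems (s : state R n m l) (x' : 'cV[R]_n) (y' : 'cV[R]_m)
    (z' : 'cV[R]_l) : Prop :=
  let beta := st_beta s in
  let betay := st_betay s in
  let L := aug_lagrangian f g A beta in
  [/\ is_argmin setT (fun x => L x (st_y s) (st_z s) (st_lam s) +
        (beta_x betay beta / 2 * enorm (x - st_x s) ^+ 2)%R%:E)%E x',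
      is_argmin setT (fun y => L x' y (st_z s) (st_lam s) +
        (betay / 2 * enorm (y - st_y s) ^+ 2)%R%:E)%E y' &
      is_argmin Z (fun z => L x' y' z (st_lam s)) z'].

Definition residual (x : 'cV[R]_n) (y : 'cV[R]_m) (z : 'cV[R]_l) : R :=
  Num.max `|grad_f f x + A^T *m grad_y g y z| `|A *m x - y|.

Definition advance (s : state R n m l) (x' : 'cV[R]_n) (y' : 'cV[R]_m)
    (z' : 'cV[R]_l) : state R n m l :=
  let Theta := residual x' y' (st_z s) in
  let Lambda :=
    (objective f g A (st_xbest s) (st_zbest s) +
     (1 - eta)%R%:E * (g (col_mx y' z') - g (col_mx y' (st_zbest s))))%E in
  let accept :=
    (objective f g A x' z' < Lambda)%E && (Theta <= eta ^+ st_K s) in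
  let z1 := if accept then z' else st_z s in
  let xb := if accept then x' else st_xbest s in
  let zb := if accept then z' else st_zbest s in
  let K1 := if accept then (st_K s).+1 else st_K s in
  let lam1 := st_lam s + st_beta s *: (A *m x' - y') in
  if objective f g A x' z1 == +oo%E
  then State xb (A *m xb) zb (grad_y g (A *m xb) zb) xb zb K1
         (kappay * st_betay s) (kappa * st_beta s)
  else State x' y' z1 lam1 xb zb K1 (st_betay s) (st_beta s).

Inductive bcadmm_step (s : state R n m l) : outcome R n m l -> Prop :=
| step_return x' y' z' :
    subproblems s x' y' z' -> residual x' y' z' <= eps ->
    bcadmm_step s (Return x' y' z')
| step_continue x' y' z' :
    subproblems s x' y' z' -> ~ (residual x' y' z' <= eps) ->
    bcadmm_step s (Continue (advance s x' y' z')).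

End Algorithm.

(* states reached after finitely many iterations without returning *)
Inductive reachable (R : realType) (n m l : nat)
    (step : state R n m l -> outcome R n m l -> Prop) (s0 : state R n m l)
    : state R n m l -> Prop :=
| reach_init : reachable step s0 s0
| reach_step s s' :
    reachable step s0 s -> step s (Continue s') -> reachable step s0 s'.

(* Main.v *)
(* Each best pair (xb, zb) is also the pair whose z is used in the x- and
   y-steps, so between two accepted updates the method is a two-block proximal
   ADMM for the convex problem min f(x) + g(Ax, zb).  An infinite run falls into
   one of three cases.

   Infinitely many updates: the best objective decreases by at least
   (1 - eta) (g(y, zb) - g(y, z(y))) at each of them, so this gap tends to 0 along
   the updates.  As z(y) is the unique minimizer, compactness makes
   grad_y g(y, zb) close to grad_y g(y, z(y)), and Theta <= eta^K makes the
   residual of the termination test small.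

   Finitely many updates, infinitely many resets: resets restart from the same
   feasible point with beta_y and beta / beta_y growing geometrically.  For large
   penalties the augmented Lagrangian plus a multiple of |y^k - y^(k-1)|^2 is
   nonincreasing, which keeps Ax^k so close to y^k that g(Ax^k, zb) stays finite:
   no further reset can occur.

   Finitely many of both: the usual quadratic Lyapunov function of convex ADMM,
   built on a KKT point, decreases, so for some k the increments are tiny; then
   Theta is small and the objective at (x^k, zb) nearly minimal, and since the
   update is refused, g(y, zb) - g(y, z(y)) must be small as well, so the
   termination test would have succeeded. *)

Require Import Defs.
From HB Require Import structures.
From mathcomp Require Import all_boot all_order all_algebra.
From mathcomp Require Import all_classical all_reals all_analysis.
From mathcomp Require Import ring lra.

Import Order.TTheory GRing.Theory Num.Theory.
Import numFieldNormedType.Exports.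

Local Open Scope classical_set_scope.
Local Open Scope ring_scope.

Set Implicit Arguments.
Unset Strict Implicit.
Unset Printing Implicit Defensive.

(** * Euclidean norms *)

(** The factor [1 - eta] in Lambda works in both directions. Write gap for g(y, zb) - g(y, z(y)), so
    that Lambda is the best objective minus (1 - eta) gap. Since [1 - eta] is positive, an
    acceptance that gains little has a small gap. Since it is below 1, a refusal is informative too:
    once y is close to Ax, the tried objective is about f(x) + g(y, zb) - gap, hence at most the
    best objective plus a small error minus gap, and refusal leaves eta * gap below that error. The
    Theta test cannot have caused the refusal, because K is frozen and eta^K is then a fixed
    positive threshold. The obstacle is that f and g may take the value +oo, so no estimate is
    uniform on the whole domain. Every modulus (closeness of values, Lipschitz constant of the
    gradient, dependence of the gradient on z) is taken on a bounded piece of a sublevel set and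
    fixed before the iteration k is chosen; coercivity or a Lyapunov function must then place the
    iterates in that piece. *)

Section EuclideanFacts.
Context {R : realType}.

Lemma dotvE p (u v : 'cV[R]_p) : dotv u v = \sum_i u i 0 * v i 0.
Proof. by rewrite /dotv mxE; apply: eq_bigr => i _; rewrite mxE. Qed.

Lemma dotvC p (u v : 'cV[R]_p) : dotv u v = dotv v u.
Proof. by rewrite !dotvE; apply: eq_bigr => i _; rewrite mulrC. Qed.

Lemma dotvDr p (u v w : 'cV[R]_p) : dotv u (v + w) = dotv u v + dotv u w.
Proof. by rewrite /dotv mulmxDr mxE. Qed.

Lemma dotvDl p (u v w : 'cV[R]_p) : dotv (v + w) u = dotv v u + dotv w u.
Proof. by rewrite dotvC dotvDr !(dotvC u). Qed.

Lemma dotvZr p a (u v : 'cV[R]_p) : dotv u (a *: v) = a * dotv u v.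
Proof. by rewrite /dotv -scalemxAr mxE. Qed.

Lemma dotvZl p a (u v : 'cV[R]_p) : dotv (a *: u) v = a * dotv u v.
Proof. by rewrite dotvC dotvZr dotvC. Qed.

Lemma dotvNr p (u v : 'cV[R]_p) : dotv u (- v) = - dotv u v.
Proof. by rewrite -scaleN1r dotvZr mulN1r. Qed.

Lemma dotvNl p (u v : 'cV[R]_p) : dotv (- u) v = - dotv u v.
Proof. by rewrite dotvC dotvNr dotvC. Qed.

Lemma dotv0r p (u : 'cV[R]_p) : dotv u 0 = 0.
Proof. by rewrite -(scale0r u) dotvZr mul0r. Qed.

Lemma dotv0l p (u : 'cV[R]_p) : dotv 0 u = 0.
Proof. by rewrite dotvC dotv0r. Qed.

Definition dotvLin := (dotvDl, dotvDr, dotvNl, dotvNr, dotvZl, dotvZr).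

Lemma dotv_delta p (u : 'cV[R]_p) i : dotv u (delta_mx i 0) = u i 0.
Proof.
rewrite dotvE (bigD1 i)//= mxE !eqxx mulr1 big1 ?addr0// => j ji.
by rewrite mxE (negbTE ji) mulr0.
Qed.

Lemma eq_dotvP p (u v : 'cV[R]_p) :
  (forall w, dotv u w = dotv v w) -> u = v.
Proof.
by move=> uv; apply/matrixP => i j; rewrite ord1 -!dotv_delta.
Qed.

Lemma dotv_mulmx p q (A : 'M[R]_(p, q)) u v :
  dotv u (A *m v) = dotv (A^T *m u) v.
Proof. by rewrite /dotv trmx_mul trmxK mulmxA. Qed.

Lemma enorm_ge0 p (v : 'cV[R]_p) : 0 <= enorm v.
Proof. exact: sqrtr_ge0. Qed.

Lemma enorm_sqr p (v : 'cV[R]_p) : enorm v ^+ 2 = dotv v v.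
Proof.
rewrite /enorm sqr_sqrtr; last by apply: sumr_ge0 => i _; exact: sqr_ge0.
by rewrite dotvE; apply: eq_bigr => i _; rewrite expr2.
Qed.

Lemma dotvv_ge0 p (v : 'cV[R]_p) : 0 <= dotv v v.
Proof. by rewrite -enorm_sqr sqr_ge0. Qed.

Lemma dotv_sqr_le p (u v : 'cV[R]_p) :
  dotv (u + v) (u + v) <= 2 * dotv u u + 2 * dotv v v.
Proof.
have := dotvv_ge0 (u - v); rewrite !dotvLin (dotvC v u); lra.
Qed.

(** Cauchy-Schwarz: with a = u.u, b = u.v, c = v.v, the square of |a v - b u| is a (a c - b^2). *)
Lemma dotv_le p (u v : 'cV[R]_p) : dotv u v <= enorm u * enorm v.
Proof.
have [u0|u0] := eqVneq (dotv u u) 0.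
  have -> : u = 0.
    apply/matrixP => i j; rewrite ord1 mxE; apply/eqP; rewrite -sqrf_eq0.
    rewrite eq_le sqr_ge0 andbT -u0 dotvE (bigD1 i)//= expr2 lerDl.
    by apply: sumr_ge0 => k _; rewrite -expr2 sqr_ge0.
  by rewrite dotv0l mulr_ge0// enorm_ge0.
have up : 0 < dotv u u by rewrite lt_neqAle eq_sym u0 dotvv_ge0.
apply: (le_trans (ler_norm _)).
rewrite -ler_sqr ?nnegrE ?mulr_ge0 ?enorm_ge0// exprMn !enorm_sqr.
rewrite real_normK ?num_real//.
have := dotvv_ge0 (dotv u u *: v - dotv u v *: u).
rewrite !dotvLin (dotvC v u); set a := dotv u u; set b := dotv u v.
set c := dotv v v => h.
rewrite -subr_ge0 -(pmulr_rge0 _ up); apply: le_trans h _.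
by rewrite -/a le_eqVlt; apply/orP; left; apply/eqP; ring.
Qed.

Lemma enormZ p a (v : 'cV[R]_p) : enorm (a *: v) = `|a| * enorm v.
Proof.
apply/eqP; rewrite -(@eqrXn2 _ 2)// ?mulr_ge0 ?enorm_ge0//.
by rewrite exprMn !enorm_sqr !dotvLin real_normK ?num_real// expr2 mulrA.
Qed.

Lemma enormN p (v : 'cV[R]_p) : enorm (- v) = enorm v.
Proof. by rewrite -scaleN1r enormZ normrN normr1 mul1r. Qed.

Lemma enormB p (u v : 'cV[R]_p) : enorm (u - v) = enorm (v - u).
Proof. by rewrite -enormN opprB. Qed.

Lemma enorm0 p : enorm (0 : 'cV[R]_p) = 0.
Proof. by rewrite -(scale0r 0) enormZ normr0 mul0r. Qed.

Lemma enormD p (u v : 'cV[R]_p) : enorm (u + v) <= enorm u + enorm v.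
Proof.
rewrite -ler_sqr ?nnegrE ?addr_ge0 ?enorm_ge0// sqrrD !enorm_sqr !dotvLin.
by rewrite (dotvC v u); have := dotv_le u v; lra.
Qed.

Lemma enorm_le p (v : 'cV[R]_p) (r : R) :
  0 <= r -> dotv v v <= r ^+ 2 -> enorm v <= r.
Proof.
by move=> r0 h; rewrite -ler_sqr ?nnegrE ?enorm_ge0// enorm_sqr.
Qed.

Lemma coord_le_norm p (v : 'cV[R]_p) i : `|v i 0| <= `|v|.
Proof.
rewrite [leRHS]/Num.norm /= mx_normrE; apply/bigmax_geP; right => /=.
by exists (i, 0).
Qed.

Lemma norm_le_coord p (v : 'cV[R]_p) r :
  0 <= r -> (forall i, `|v i 0| <= r) -> `|v| <= r.
Proof.
move=> r0 h; rewrite [leLHS]/Num.norm /= mx_normrE; apply/bigmax_leP.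
by split=> // -[i j] _ /=; rewrite ord1.
Qed.

Lemma norm_le_enorm p (v : 'cV[R]_p) : `|v| <= enorm v.
Proof.
apply: norm_le_coord (enorm_ge0 _) _ => i.
rewrite -ler_sqr ?nnegrE ?enorm_ge0// real_normK ?num_real// enorm_sqr dotvE.
rewrite (bigD1 i)//= expr2 lerDl.
by apply: sumr_ge0 => k _; rewrite -expr2 sqr_ge0.
Qed.

Lemma enorm_le_norm p (v : 'cV[R]_p) : enorm v <= p%:R * `|v|.
Proof.
apply: enorm_le; first by rewrite mulr_ge0.
rewrite exprMn dotvE (@le_trans _ _ (\sum_(i < p) `|v| ^+ 2))//.
  apply: ler_sum => i _; rewrite -expr2 -[v i 0 ^+ 2]real_normK ?num_real//.
  by rewrite ler_sqr ?nnegrE// coord_le_norm.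
rewrite sumr_const card_ord -[leLHS]mulr_natl ler_wpM2r ?sqr_ge0//.
by rewrite -natrX ler_nat; case: (p) => // k; rewrite expnS expn1 leq_pmulr.
Qed.

Lemma mulmx_bound p q (A : 'M[R]_(p, q)) :
  exists2 a, 0 < a & forall v, enorm (A *m v) <= a * enorm v.
Proof.
pose s := \sum_i \sum_j `|A i j|.
have s0 : 0 <= s by apply: sumr_ge0 => i _; apply: sumr_ge0.
(* The [+ 1] keeps the bound positive when [A = 0], so that it can be divided by. *)
exists (p%:R * s + 1); first by rewrite ltr_wpDl// mulr_ge0.
move=> v; apply: le_trans (enorm_le_norm _) _.
rewrite mulrDl mul1r -mulrA ler_wpDr ?enorm_ge0// ler_wpM2l//.
apply: norm_le_coord => [|i]; first by rewrite mulr_ge0 ?enorm_ge0.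
rewrite mxE (le_trans (ler_norm_sum _ _ _))// /s mulr_suml (bigD1 i)//=.
apply: ler_wpDr.
  by apply: sumr_ge0 => k _; rewrite mulr_ge0 ?enorm_ge0 ?sumr_ge0.
rewrite mulr_suml ler_sum// => j _; rewrite normrM ler_wpM2l//.
exact: le_trans (coord_le_norm _ _) (norm_le_enorm _).
Qed.

Lemma dotv_col_mx p q (a c : 'cV[R]_p) (b d : 'cV[R]_q) :
  dotv (col_mx a b) (col_mx c d) = dotv a c + dotv b d.
Proof. by rewrite /dotv tr_col_mx mul_row_col mxE. Qed.

Lemma enorm_col_mx_le p q (a : 'cV[R]_p) (b : 'cV[R]_q) :
  enorm (col_mx a b) <= enorm a + enorm b.
Proof.
apply: enorm_le; first by rewrite addr_ge0 ?enorm_ge0.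
rewrite dotv_col_mx sqrrD !enorm_sqr.
by have := mulr_ge0 (enorm_ge0 a) (enorm_ge0 b); lra.
Qed.

Lemma enorm_col_mxl p q (a : 'cV[R]_p) (b : 'cV[R]_q) :
  enorm a <= enorm (col_mx a b).
Proof.
apply: enorm_le (enorm_ge0 _) _.
by rewrite enorm_sqr dotv_col_mx lerDl dotvv_ge0.
Qed.

Lemma enorm_col_mxr p q (a : 'cV[R]_p) (b : 'cV[R]_q) :
  enorm b <= enorm (col_mx a b).
Proof.
apply: enorm_le (enorm_ge0 _) _.
by rewrite enorm_sqr dotv_col_mx lerDr dotvv_ge0.
Qed.

Lemma enorm_usubmx p q (v : 'cV[R]_(p + q)) : enorm (usubmx v) <= enorm v.
Proof. by rewrite -[in leRHS](vsubmxK v) enorm_col_mxl. Qed.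

Lemma opnorm_has_sup p q (M : 'M[R]_(p, q)) :
  has_sup [set enorm (M *m v) | v in [set v : 'cV[R]_q | enorm v <= 1]].
Proof.
split; first by exists (enorm (M *m 0)), 0 => //=; rewrite enorm0.
have [a a0 Ma] := mulmx_bound M; exists a => _ [v /= v1 <-].
by rewrite (le_trans (Ma v))// -[leRHS]mulr1 ler_wpM2l// ltW.
Qed.

Lemma opnorm_ge0 p q (M : 'M[R]_(p, q)) : 0 <= opnorm M.
Proof.
apply: sup_upper_bound (opnorm_has_sup M) _ _.
by exists 0; rewrite /= ?enorm0// mulmx0 enorm0.
Qed.

(** On the unit ball |Av|^2 is the inner product of A^T A v with v, hence 0; scaling by 1 / (|v| +
    1) reaches every [v]. *)
Lemma opnorm_gram_eq0 p q (A : 'M[R]_(p, q)) :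
  opnorm (A^T *m A) = 0 -> forall v : 'cV[R]_q, A *m v = 0.
Proof.
move=> op0 v.
have small w : enorm w <= 1 -> A *m w = 0.
  move=> w1.
  have : enorm (A^T *m A *m w) <= 0.
    by rewrite -op0; apply: sup_upper_bound (opnorm_has_sup _) _ _; exists w.
  move=> le0; have : enorm (A *m w) <= 0.
    apply: enorm_le => //; rewrite expr0n/= dotv_mulmx mulmxA.
    rewrite (le_trans (dotv_le _ _))// -[leRHS](mul0r (enorm w)).
    by rewrite ler_wpM2r ?enorm_ge0.
  move=> /(le_trans (norm_le_enorm _)); rewrite normr_le0 => /eqP.
  exact.
have e1 : 0 < enorm v + 1 by rewrite ltr_wpDl ?enorm_ge0.
have /small : enorm ((enorm v + 1)^-1 *: v) <= 1.
  rewrite enormZ ger0_norm; last by rewrite invr_ge0 ltW.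
  by rewrite ler_pdivrMl// mulr1 lerDl.
rewrite -scalemxAr => /(congr1 (fun u => (enorm v + 1) *: u)).
by rewrite scalerA divff ?gt_eqF// scale1r scaler0.
Qed.

(** Avoids square roots when Lyapunov bounds on squares become bounds on norms. *)
Lemma le_one_plus_sqr (u c : R) : u ^+ 2 <= c -> u <= 1 + c.
Proof. by move=> uc; have := sqr_ge0 (u - 1); rewrite sqrrB expr1n; nra. Qed.

Lemma small_of_sqr (k e u : R) : 0 < k -> 0 <= e -> 0 <= u ->
  k * u ^+ 2 <= e ^+ 2 * k -> u <= e.
Proof.
move=> k0 e0 u0; rewrite mulrC ler_pM2r// => ue.
by rewrite -ler_sqr ?nnegrE.
Qed.

End EuclideanFacts.

(** * Limits and compactness *)

Section Sequences.
Context {R : realType}.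

(** Links the topology, given by the sup norm, to the Euclidean norm; the latter is at most [p]
    times the former. *)
Lemma cvg_enormP p I (F : set_system I) {FF : Filter F} (u : I -> 'cV[R]_p)
    (l : 'cV[R]_p) :
  u @ F --> l <-> forall e : R, 0 < e -> \forall i \near F, enorm (u i - l) <= e.
Proof.
split=> [/cvgrPdist_le ul e e0|h].
  have /ul : 0 < e / p.+1%:R by rewrite divr_gt0.
  apply: filterS => i; rewrite distrC => le; apply: le_trans (enorm_le_norm _) _.
  rewrite (le_trans (ler_wpM2l _ le))// mulrCA ger_pMr//.
  by rewrite ler_pdivrMr// mul1r ler_nat.
apply/cvgrPdist_le => e /h; apply: filterS => i; rewrite enormB.
exact: le_trans (norm_le_enorm _).
Qed.

(** An ultrafilter contains the preimage of a neighbourhood or of its complement, and a cluster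
    point rules out the complement. *)
Lemma ultra_cluster_cvg (T : topologicalType) I (U : set_system I)
    (UU : UltraFilter U) (u : I -> T) (p : T) :
  cluster (u @ U) p -> u @ U --> p.
Proof.
move=> clp B Bp; have [//|nB] := in_ultra_setVsetC (u @^-1` B) UU.
by have [x [/= nBx Bx]] := clp (~` B) B nB Bp.
Qed.

Lemma bounded_ultra_cvg p I (U : set_system I) (UU : UltraFilter U)
    (u : I -> 'cV[R]_p) r :
  (forall i, enorm (u i) <= r) -> exists l : 'cV[R]_p, u @ U --> l.
Proof.
move=> ur.
have cv j : exists x : R, (fun i => u i j 0) @ U --> x.
  have PF : ProperFilter ((fun i => u i j 0) @ U) by exact: fmap_proper_filter.
  have := @segment_compact R (- r) r.
  move=> /(_ _ PF)[|x [_ /ultra_cluster_cvg h]].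
    apply: (@nearW _ U) => i /=; rewrite in_itv/= -ler_norml.
    exact: le_trans (coord_le_norm _ _) (le_trans (norm_le_enorm _) (ur i)).
  by exists x.
have [x xP] := choice cv; exists (\col_j x j).
apply/cvgrPdist_le => e e0.
have : \forall i \near U, forall j, `|x j - u i j 0| <= e.
  by apply: filter_forall => j; move/cvgrPdist_le : (xP j); exact.
apply: filterS => i h; apply: norm_le_coord (ltW e0) _ => j.
by rewrite !mxE.
Qed.

(* Along a fixed ultrafilter finer than [\oo] every bounded sequence converges,
   so several sequences have simultaneous limits without extracting
   subsequences. *)
Lemma ultra_eventually :
  exists U : set_system nat, UltraFilter U /\ \oo `<=` U.
Proof. by apply: ultraFilterLemma; exact: eventually_filter. Qed.

Lemma near_natSinv (U : set_system nat) {FU : Filter U} (e : R) : \oo `<=` U -> 0 < e ->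
  \forall n \near U, n.+1%:R^-1 < e.
Proof.
by move=> oU e0; exact: (oU _ (near_infty_natSinv_lt (PosNum e0))).
Qed.

Section Limits.
Context {I : Type} {F : set_system I} {FF : ProperFilter F}.

Lemma cvg_col_mx p q (u : I -> 'cV[R]_p) (v : I -> 'cV[R]_q)
    (a : 'cV[R]_p) (b : 'cV[R]_q) :
  u @ F --> a -> v @ F --> b -> col_mx (u i) (v i) @[i --> F] --> col_mx a b.
Proof.
move=> /cvg_enormP ua /cvg_enormP vb; apply/cvg_enormP => e e0.
have e2 : 0 < e / 2 by rewrite divr_gt0.
apply: filterS2 (ua _ e2) (vb _ e2) => i h1 h2.
rewrite opp_col_mx add_col_mx (le_trans (enorm_col_mx_le _ _))//.
by rewrite [e]splitr lerD.
Qed.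

Lemma cvg_mulmx p q (A : 'M[R]_(p, q)) (u : I -> 'cV[R]_q)
    (a : 'cV[R]_q) :
  u @ F --> a -> A *m u i @[i --> F] --> A *m a.
Proof.
have [c c0 Ac] := mulmx_bound A.
move=> /cvg_enormP ua; apply/cvg_enormP => e e0.
have /ua : 0 < e / c by rewrite divr_gt0.
apply: filterS => i h; rewrite -mulmxBr (le_trans (Ac _))//.
by rewrite mulrC -ler_pdivlMr.
Qed.

Lemma cvg_near_eq p (u v : I -> 'cV[R]_p) (d : I -> R) (a : 'cV[R]_p) :
  u @ F --> a -> (forall i, enorm (v i - u i) <= d i) ->
  (forall e, 0 < e -> \forall i \near F, d i < e) -> v @ F --> a.
Proof.
move=> /cvg_enormP ua vu d0; apply/cvg_enormP => e e0.
have e2 : 0 < e / 2 by rewrite divr_gt0.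
apply: filterS2 (ua _ e2) (d0 _ e2) => i h1 h2.
rewrite -(subrKA (u i)) (le_trans (enormD _ _))// [e]splitr lerD//.
exact: le_trans (vu i) (ltW h2).
Qed.

Lemma closed_cvg_mem (T : topologicalType) (Z : set T) (u : I -> T) (a : T) :
  closed Z -> (forall i, Z (u i)) -> u @ F --> a -> Z a.
Proof. by move=> cZ Zu; apply: (@closed_cvg _ _ F _ u Z cZ); exact: nearW. Qed.

End Limits.

Lemma continuous_comp_seq (T T' : topologicalType) I (F : set_system I)
    {FF : Filter F} (h : T -> T') (u : I -> T) (a : T) :
  continuous h -> u @ F --> a -> h (u i) @[i --> F] --> h a.
Proof. by move=> ch ua; apply: continuous_cvg => //; exact: ch. Qed.

(** Uniform upper semicontinuity, which also yields finiteness of [g v]. Only [u] is confined to a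
    bounded sublevel set; in a sequence of counterexamples [u] and [v] tend to the same point, where
    [g] is still at most [M], and continuity there is violated. *)
Lemma usc_near_sublevel p (g : 'cV[R]_p -> \bar R) (r M e : R) :
  (forall v, (0 <= g v)%E) -> continuous g -> 0 < e ->
  exists2 d, 0 < d & forall u v, enorm u <= r -> (g u <= M%:E)%E ->
    enorm (v - u) <= d -> (g v <= g u + e%:E)%E.
Proof.
move=> g0 cg e0; apply: contrapT => nex.
have bad n : exists uv : 'cV[R]_p * 'cV[R]_p,
    [/\ enorm uv.1 <= r, (g uv.1 <= M%:E)%E,
        enorm (uv.2 - uv.1) <= n.+1%:R^-1 & (g uv.1 + e%:E < g uv.2)%E].
  apply: contrapT => nuv; apply: nex; exists n.+1%:R^-1 => // u v ur gu vu.
  by rewrite leNgt; apply/negP => h; apply: nuv; exists (u, v).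
have [w wP] := choice bad.
have [U [UU oU]] := ultra_eventually.
have [a ua] : exists a : 'cV[R]_p, (fun n => (w n).1) @ U --> a.
  by apply: (@bounded_ultra_cvg _ _ _ _ _ r) => n; have [] := wP n.
have va : (fun n => (w n).2) @ U --> a.
  apply: (@cvg_near_eq _ _ _ _ _ _ (fun n => n.+1%:R^-1) _ ua).
    by move=> n; have [] := wP n.
  by move=> x x0; exact: near_natSinv.
have gua : g (w n).1 @[n --> U] --> g a by exact: continuous_comp_seq.
have gva : g (w n).2 @[n --> U] --> g a by exact: continuous_comp_seq.
have gaM : (g a <= M%:E)%E.
  by apply: (cvge_to_le gua); apply: nearW => n; have [] := wP n.
have gaf : g a \is a fin_num.
  by rewrite ge0_fin_numE ?g0// (le_lt_trans gaM)// ltry.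
rewrite -(fineK gaf) in gua gva.
have h2 : \forall n \near U, (g (w n).2 < (fine (g a) + e / 2)%:E)%E.
  apply: (gva [set x | (x < (fine (g a) + e / 2)%:E)%E]).
  by apply: open_ereal_lt'; rewrite lte_fin ltrDl divr_gt0.
have h1 : \forall n \near U, ((fine (g a) - e / 2)%:E < g (w n).1)%E.
  apply: (gua [set x | ((fine (g a) - e / 2)%:E < x)%E]).
  by apply: open_ereal_gt'; rewrite lte_fin gtrBl divr_gt0.
have [n []] := filter_ex (filterI h1 h2); have [_ w1 _] := wP n.
have : g (w n).1 \is a fin_num.
  by rewrite ge0_fin_numE ?g0// (le_lt_trans w1)// ltry.
move=> /fineK <-; rewrite -EFinD lte_fin => w12 + w2.
have := lt_trans w12 w2; rewrite !lte_fin; lra.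
Qed.

(** Direct method: a minimizing sequence is bounded by coercivity, and its limit along an
    ultrafilter attains the infimum. *)
Lemma coercive_argmin p (F : 'cV[R]_p -> \bar R) (c : R) :
  (forall v, (c%:E <= F v)%E) -> continuous F -> coercive F ->
  exists a, is_argmin setT F a.
Proof.
move=> Fc cF coF; have [[a0 Fa0]|nex] := pselect (exists a, (F a < +oo)%E).
- pose S : set R := [set x | exists v, F v = x%:E].
  have SP v : (F v < +oo)%E -> F v = (fine (F v))%:E.
    move=> Fv; rewrite fineK// fin_numElt Fv andbT.
    by rewrite (lt_le_trans _ (Fc v))// ltNyr.
  have Sc x : S x -> c <= x by move=> [v Fv]; rewrite -lee_fin -Fv.
  have iS : has_inf S.
    by split; [exists (fine (F a0)), a0; exact: SP | exists c => x /Sc].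
  have small n : exists v, (F v < (inf S + n.+1%:R^-1)%:E)%E.
    have [|x [v Fv] xlt] := @inf_adherent _ _ n.+1%:R^-1 _ iS; first by [].
    by exists v; rewrite Fv lte_fin.
  have [v vP] := choice small.
  have [r rP] := coF (inf S + 1).
  have vr n : enorm (v n) <= r.
    rewrite leNgt; apply/negP => /ltW/rP /le_lt_trans/(_ (vP n)).
    by rewrite lte_fin ltrD2l ltNge invf_le1// ler1n.
  have [U [UU oU]] := ultra_eventually.
  have [a va] := bounded_ultra_cvg UU vr.
  have Fva : F (v n) @[n --> U] --> F a by exact: continuous_comp_seq.

  exists a; split=> // b _.
  have [Fb|] := ltP (F b) +oo%E; last by rewrite leye_eq => /eqP ->; exact: leey.
  have iFb : inf S <= fine (F b) by apply: (ge_inf iS.2); exists b; exact: SP.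
  rewrite (SP b Fb); apply/lee_addgt0Pr => e e0.
  apply: (cvge_to_le Fva).
  apply: (filterS _ (near_natSinv oU e0)) => n ne; apply: le_trans (ltW (vP n)) _.
  by rewrite -EFinD lee_fin lerD// ltW.
(* Here [F] is identically +oo, so every point is a minimizer. *)
- exists 0; split=> // b _; rewrite leNgt; apply/negP => lt.
  by apply: nex; exists b; rewrite (lt_le_trans lt)// leey.
Qed.
End Sequences.

(** * Gradients of convex functions *)

Section Gradients.
Context {R : realType}.

Lemma differentiable_is_derive p (h : 'cV[R]_p -> R) x v :
  differentiable h x -> is_derive x v h (dotv (grad h x) v).
Proof.
move=> dh; apply: DeriveDef; first exact: diff_derivable.
rewrite deriveE// dotvE {1}[v]matrix_sum_delta linear_sum /=.
apply: eq_bigr => i _; rewrite big_ord1 linearZ /= mxE deriveE//.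
by rewrite [RHS]mulrC.
Qed.

Lemma frechet_remainder p (h : 'cV[R]_p -> R) x (e : R) :
  differentiable h x -> 0 < e ->
  exists2 r, 0 < r & forall w, enorm (w - x) <= r ->
    `|h w - h x - dotv (grad h x) (w - x)| <= e * enorm (w - x).
Proof.
move=> dh e0; have := diff_locally dh; move/eqaddoP => /(_ e e0).
move=> /nbhs_ballP[r /= r0 hr]; exists (r / 2); first by rewrite divr_gt0.
move=> w wr; have /hr : ball (0 : 'cV[R]_p) r (w - x).
  rewrite -ball_normE /= sub0r normrN (le_lt_trans (norm_le_enorm _))//.
  by rewrite (le_lt_trans wr)// ltr_pdivrMr// ltr_pMr// ltr1n.
have -> : dotv (grad h x) (w - x) = 'd h x (w - x).
  have [_ <-] := differentiable_is_derive (w - x) dh.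
  by rewrite deriveE.
rewrite !fctE /= subrK opprD addrA => /le_trans; apply.
by apply: ler_wpM2l (ltW e0) _ _ _; exact: norm_le_enorm.
Qed.

(* The Frechet expansion in [cs_frechet] is what differentiability is used for;
   unlike [differentiable] it passes to [y |-> g (y, z)] by restriction. *)
Record convex_smooth p (h : 'cV[R]_p -> \bar R) : Prop := ConvexSmooth {
  cs_ge0 : forall v, (0 <= h v)%E ;
  cs_continuous : continuous h ;
  cs_convex : econvex h ;
  cs_frechet : forall x e, edom h x -> 0 < e ->
    exists2 r, 0 < r & forall w, enorm (w - x) <= r ->
      `|fine (h w) - fine (h x) - dotv (grad (fine \o h) x) (w - x)|
        <= e * enorm (w - x) }.

Lemma edom_fin p (h : 'cV[R]_p -> \bar R) x :
  (0 <= h x)%E -> edom h x -> h x = (fine (h x))%:E.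
Proof. by move=> h0 hx; rewrite fineK// ge0_fin_numE. Qed.

Lemma convex_sublevel p (k : 'cV[R]_p -> \bar R) u v (t M : R) :
  convex_smooth k -> 0 <= t <= 1 -> edom k u -> edom k v ->
  fine (k u) <= M -> fine (k v) <= M ->
  edom k (t *: u + (1 - t) *: v) /\ fine (k (t *: u + (1 - t) *: v)) <= M.
Proof.
move=> ck t01 ku kv uM vM; have := cs_convex ck u v t01.
rewrite (edom_fin (cs_ge0 ck u) ku) (edom_fin (cs_ge0 ck v) kv) -!EFinM -EFinD.
set w := _ + _ *: v => kw; have kwd : edom k w by apply: (le_lt_trans kw); rewrite ltry.
split=> //; move: kw; rewrite (edom_fin (cs_ge0 ck w) kwd) lee_fin /= => kw.
case/andP: t01 => t0 t1; have s0 : 0 <= 1 - t by rewrite subr_ge0.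
have := ler_wpM2l t0 uM; have := ler_wpM2l s0 vM; lra.
Qed.

Lemma edom_open p (h : 'cV[R]_p -> \bar R) x :
  (forall v, (0 <= h v)%E) -> continuous h -> edom h x ->
  exists2 r, 0 < r & forall w, enorm (w - x) <= r -> edom h w.
Proof.
move=> h0 ch hx.
have [r r0 hr] := usc_near_sublevel (enorm x) (fine (h x)) h0 ch ltr01.
exists r => // w wx; have := hr x w (lexx _) _ wx.
rewrite -edom_fin// lexx => /(_ isT) /le_lt_trans; apply.
by rewrite lte_add_pinfty// ltry.
Qed.

Section Convex.
Context {p : nat} {h : 'cV[R]_p -> \bar R} (hcs : convex_smooth h).
Let G := grad (fine \o h).

(** Compares convexity with the Frechet expansion at the point [t *: u + (1 - t) *: x]; after
    division by [t] only the arbitrary error [e] remains. *)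
Lemma gradient_inequality x u : edom h x -> edom h u ->
  fine (h x) + dotv (G x) (u - x) <= fine (h u).
Proof.
move=> hx hu; apply/ler_addgt0Pl => e e0.
pose N := enorm (u - x) + 1.
have N0 : 0 < N by rewrite ltr_wpDl// enorm_ge0.
have [r r0 hr] := cs_frechet hcs hx (divr_gt0 e0 N0).
pose t := Num.min 1 (r / N).
have t0 : 0 < t by rewrite lt_min ltr01 divr_gt0.
have t1 : t <= 1 by rewrite ge_min lexx.
have tN : t * enorm (u - x) <= r.
  have : t <= r / N by rewrite ge_min lexx orbT.
  rewrite ler_pdivlMr// => /(le_trans _); apply.
  by rewrite ler_wpM2l ?(ltW t0)// /N lerDl.
have wE : t *: u + (1 - t) *: x - x = t *: (u - x).
  by rewrite scalerBl scale1r scalerBr -addrA [x - _ - x]addrAC subrr sub0r.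
have := cs_convex hcs u x (t := t); rewrite (ltW t0) t1 => /(_ isT).
rewrite (edom_fin (cs_ge0 hcs x) hx) (edom_fin (cs_ge0 hcs u) hu).
set w := _ + (1 - t) *: x.
move=> hw; have hwd : edom h w by apply: (le_lt_trans hw); rewrite ltry.
move: hw; rewrite (edom_fin (cs_ge0 hcs w) hwd) -!EFinM -EFinD lee_fin => hw.
have := hr w; rewrite wE enormZ gtr0_norm// => /(_ tN).
rewrite dotvZr ler_norml => /andP[+ _].
have : e / N * (t * enorm (u - x)) <= t * e.
  rewrite mulrCA ler_wpM2l ?(ltW t0)// mulrAC ler_pdivrMr//.
  by rewrite ler_wpM2l ?(ltW e0)// /N lerDl.
rewrite -/G /=; move: hw; set a := fine _; set b := fine _; set c := fine _.
set d := dotv _ _ => h1 h2 h3.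
suff : 0 <= t * (e + b - c - d) by rewrite pmulr_rge0//; lra.
lra.
Qed.

Lemma gradient_monotone x u : edom h x -> edom h u ->
  0 <= dotv (G x - G u) (x - u).
Proof.
move=> hx hu; have := gradient_inequality hx hu.
have := gradient_inequality hu hx; rewrite !dotvLin; lra.
Qed.

(** First-order condition of the subproblems: [a] is the linear part of the added quadratic and [c]
    any constant dominating its second-order part, which disappears after testing with [x + t *: v]
    and dividing by [t]. *)
Lemma quadratic_fermat x a (c : R) : edom h x ->
  (forall w, edom h w -> fine (h x) <=
     fine (h w) + dotv a (w - x) + c * dotv (w - x) (w - x)) ->
  G x = - a.
Proof.
move=> hx hmin; have [r1 r10 hr1] := edom_open (cs_ge0 hcs) (cs_continuous hcs) hx.
suff ge0 v : 0 <= dotv (G x + a) v.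
  apply/eqP; rewrite -subr_eq0 opprK; apply/eqP/eq_dotvP => w.
  have := ge0 w; have := ge0 (- w); rewrite dotv0l dotvNr oppr_ge0 => h1 h2.
  by apply/eqP; rewrite eq_le h1 h2.
apply/ler_addgt0Pl => e e0.
pose N := enorm v + 1.
have N0 : 0 < N by rewrite ltr_wpDl// enorm_ge0.
have e2 : 0 < e / 2 by rewrite divr_gt0.
have [r r0 hr] := cs_frechet hcs hx (divr_gt0 e2 N0).
pose C := `|c| * dotv v v + 1.
have C0 : 0 < C by rewrite ltr_wpDl// mulr_ge0 ?dotvv_ge0.
(* The first bound keeps the test point in the domain and within reach of the expansion; the second
   makes the quadratic term cost at most [e / 2] after division by [t]. *)
pose t := Num.min (Num.min r r1 / N) (e / 2 / C).
have t0 : 0 < t by rewrite lt_min !divr_gt0// lt_min r0.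
have tv : t * enorm v <= Num.min r r1.
  have : t <= Num.min r r1 / N by rewrite ge_min lexx.
  rewrite ler_pdivlMr// => /(le_trans _); apply.
  by rewrite ler_wpM2l ?(ltW t0)// /N lerDl.
have tC : t * C <= e / 2 by rewrite -ler_pdivlMr// ge_min lexx orbT.
pose w := x + t *: v.
have wE : w - x = t *: v by rewrite /w addrC addKr.
have wn : enorm (w - x) <= Num.min r r1 by rewrite wE enormZ gtr0_norm.
have hw : edom h w by apply: hr1; rewrite (le_trans wn)// ge_min lexx orbT.
have := hr w; rewrite (le_trans wn) ?ge_min ?lexx// => /(_ isT).
have := hmin w hw; rewrite wE !dotvLin enormZ (gtr0_norm t0).
have : e / 2 / N * (t * enorm v) <= t * (e / 2).
  rewrite mulrCA ler_wpM2l ?(ltW t0)// mulrAC ler_pdivrMr//.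
  by rewrite ler_wpM2l ?(ltW e2)// /N lerDl.
have cC : t * (c * dotv v v) <= e / 2.
  apply: le_trans tC; rewrite ler_wpM2l ?(ltW t0)// /C.
  rewrite (@le_trans _ _ (`|c| * dotv v v)) ?lerDl//.
  by rewrite ler_wpM2r ?dotvv_ge0// ler_norm.
have cC' : t * (t * (c * dotv v v)) <= t * (e / 2).
  by rewrite ler_wpM2l ?(ltW t0).
rewrite -/G ler_norml => h1 h2 /andP[_ h3].
suff : 0 <= t * (e + (dotv (G x) v + dotv a v)) by rewrite pmulr_rge0.
move: cC' h1 h2 h3; set A := fine _; set B := fine _.
set D := dotv _ _; set E := dotv _ _; set K := dotv _ _.
rewrite (_ : c * (t * (t * D)) = t * (t * (c * D))); last ring.
lra.
Qed.

End Convex.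
End Gradients.

(** * Partial gradients of g *)

Section PartialGradients.
Context {R : realType} {m l : nat} {g : 'cV[R]_(m + l) -> \bar R}.

Lemma mx_coord_le_norm p q (M : 'M[R]_(p, q)) i j : `|M i j| <= `|M|.
Proof.
rewrite [leRHS]/Num.norm /= mx_normrE; apply/bigmax_geP; right => /=.
by exists (i, j).
Qed.

(** The difference quotients along the two lines are the same function of [t]; this identifies
    [grad_y] and [grad_z] with the blocks of the full gradient. *)
Lemma derive_along_eq (V W : normedModType R) (F : V -> R) (H : W -> R)
    (x v : V) (x' v' : W) :
  (forall t : R, F (t *: v + x) = H (t *: v' + x')) ->
  'D_v F x = 'D_v' H x'.
Proof.
move=> FH; have FH0 : F x = H x' by have := FH 0; rewrite !scale0r !add0r.
rewrite /derive.
have -> : (fun t : R => t^-1 *: ((F \o shift x) (t *: v) - F x)) =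
          (fun t : R => t^-1 *: ((H \o shift x') (t *: v') - H x')).
  by apply/funext => t /=; rewrite FH FH0.
by [].
Qed.

Lemma is_derive_line p (H : 'cV[R]_p -> R) (d q : 'cV[R]_p) (t v : R) :
  is_derive (t *: d + q) d H v ->
  is_derive t (1 : R) (fun s : R => H (s *: d + q)) v.
Proof.
move=> [Hd Hv].
have E : (fun s : R => s^-1 *: (((fun s : R => H (s *: d + q)) \o shift t) (s *: 1)
            - H (t *: d + q))) =
         (fun s : R => s^-1 *: ((H \o shift (t *: d + q)) (s *: d)
            - H (t *: d + q))).
  apply/funext => s /=; congr (_ *: (H _ - _)).
  by rewrite [s *: 1]mulr1 scalerDl addrA.
apply: DeriveDef; first by rewrite /derivable E.
by rewrite /derive E.
Qed.

Lemma delta_col_mxl (i : 'I_m) :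
  col_mx (delta_mx i 0) 0 = delta_mx (lshift l i) 0 :> 'cV[R]_(m + l).
Proof.
apply/matrixP => k j; rewrite !mxE; case: split_ordP => k' ->; rewrite !mxE.
  by rewrite eq_lshift.
by rewrite eq_rlshift.
Qed.

Lemma delta_col_mxr (i : 'I_l) :
  col_mx 0 (delta_mx i 0) = delta_mx (rshift m i) 0 :> 'cV[R]_(m + l).
Proof.
apply/matrixP => k j; rewrite !mxE; case: split_ordP => k' ->; rewrite !mxE.
  by rewrite eq_lrshift.
by rewrite eq_rshift.
Qed.

Lemma grad_yE y z : grad_y g y z = usubmx (grad (fine \o g) (col_mx y z)).
Proof.
apply/matrixP => i j; rewrite !mxE; apply: derive_along_eq => t /=.
by rewrite -delta_col_mxl scale_col_mx add_col_mx scaler0 add0r.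
Qed.

Lemma grad_zE y z : grad_z g y z = dsubmx (grad (fine \o g) (col_mx y z)).
Proof.
apply/matrixP => i j; rewrite !mxE; apply: derive_along_eq => t /=.
by rewrite -delta_col_mxr scale_col_mx add_col_mx scaler0 add0r.
Qed.

Hypotheses (g0 : forall p, (0 <= g p)%E) (cg : continuous g).
Hypothesis g2 : C2_in_dom g.

Lemma continuous_col_mxl (z : 'cV[R]_l) :
  continuous (fun y : 'cV[R]_m => col_mx y z).
Proof.
move=> y; have h1 : (fun u : 'cV[R]_m => u) @ y --> y by exact: cvg_id.
have h2 : (fun _ : 'cV[R]_m => z) @ y --> z by apply: cst_continuous.
exact: (cvg_col_mx h1 h2).
Qed.

Lemma partial_convex_smooth (z : 'cV[R]_l) :
  econvex (fun y => g (col_mx y z)) -> convex_smooth (fun y => g (col_mx y z)).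
Proof.
move=> gz; split=> // [y|y e hy e0].
  exact: (continuous_comp (@continuous_col_mxl z y) (@cg (col_mx y z))).
have [dg _ _] := g2 hy; have [r r0 hr] := frechet_remainder dg e0.
exists r => // w wy; have wE : col_mx w z - col_mx y z = col_mx (w - y) 0.
  by rewrite opp_col_mx add_col_mx subrr.
have wn : enorm (col_mx (w - y) (0 : 'cV[R]_l)) <= enorm (w - y).
  by rewrite (le_trans (enorm_col_mx_le _ _))// enorm0 addr0.
have := hr (col_mx w z); rewrite wE => /(_ (le_trans wn wy)).
have -> : grad (fine \o (fun y0 => g (col_mx y0 z))) y = grad_y g y z by [].
rewrite grad_yE -{1}[grad _ (col_mx y z)]vsubmxK dotv_col_mx dotv0r addr0.
by move=> /le_trans; apply; rewrite ler_wpM2l// ltW.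
Qed.

Lemma grad_cvg I (F : set_system I) {FF : ProperFilter F}
    (u : I -> 'cV[R]_(m + l)) (p : 'cV[R]_(m + l)) :
  edom g p -> u @ F --> p ->
  grad (fine \o g) (u i) @[i --> F] --> grad (fine \o g) p.
Proof.
move=> gp up; have [_ /differentiable_continuous dg _] := g2 gp.
exact: continuous_cvg.
Qed.

Lemma grad_y_cvg I (F : set_system I) {FF : ProperFilter F}
    (y : I -> 'cV[R]_m) (z : I -> 'cV[R]_l) (y0 : 'cV[R]_m) (z0 : 'cV[R]_l) :
  edom g (col_mx y0 z0) -> y @ F --> y0 -> z @ F --> z0 ->
  grad_y g (y i) (z i) @[i --> F] --> grad_y g y0 z0.
Proof.
move=> gp yy zz.
have /cvg_enormP h : grad (fine \o g) (col_mx (y i) (z i)) @[i --> F] -->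
    grad (fine \o g) (col_mx y0 z0).
  by apply: grad_cvg gp _; exact: cvg_col_mx.
apply/cvg_enormP => e /h; apply: filterS => i; apply: le_trans.
by rewrite !grad_yE -linearB enorm_usubmx.
Qed.

(** Minimality makes the increment of [g] nonnegative, so the Frechet remainder alone bounds the
    pairing of [- grad_z] with [w - z]. *)
Lemma grad_z_regular_normal (Z : set 'cV[R]_l) y z :
  edom g (col_mx y z) -> Z z ->
  (forall w, Z w -> (g (col_mx y z) <= g (col_mx y w))%E) ->
  regular_normal Z z (- grad_z g y z).
Proof.
move=> gz Zz zmin; split=> // e e0.
have [dg _ _] := g2 gz; have [r r0 hr] := frechet_remainder dg e0.
have [r1 r10 hr1] := edom_open g0 cg gz.
exists (Num.min r r1); first by rewrite lt_min r0.
move=> w Zw; rewrite le_min => /andP[wr wr1].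
have wE : col_mx y w - col_mx y z = col_mx 0 (w - z).
  by rewrite opp_col_mx add_col_mx subrr.
have wn : enorm (col_mx (0 : 'cV[R]_m) (w - z)) <= enorm (w - z).
  by rewrite (le_trans (enorm_col_mx_le _ _))// enorm0 add0r.
have gw : edom g (col_mx y w).
  by apply: hr1; rewrite wE (le_trans wn).
have := zmin w Zw; rewrite (edom_fin (g0 _) gz) (edom_fin (g0 _) gw) lee_fin.
have := hr (col_mx y w); rewrite wE => /(_ (le_trans wn wr)).
rewrite grad_zE -{1}[grad _ (col_mx y z)]vsubmxK dotv_col_mx dotv0r add0r.
move=> /(le_trans (ler_norm _)) /= h1 h2; rewrite dotvNl.
have h3 : e * enorm (col_mx (0 : 'cV[R]_m) (w - z)) <= e * enorm (w - z).
  by rewrite ler_wpM2l// ltW.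
lra.
Qed.

(** Points with ever larger Hessian entries would have a limit of value at most [M], hence in the
    domain, where the Hessian is continuous. *)
Lemma hess_bounded (r M : R) : exists2 B, 0 < B & forall p,
  enorm p <= r -> (g p <= M%:E)%E -> forall i j, `|hess (fine \o g) p i j| <= B.
Proof.
apply: contrapT => nex.
have bad n : exists p : 'cV[R]_(m + l), [/\ enorm p <= r, (g p <= M%:E)%E &
    exists i j, n.+1%:R < `|hess (fine \o g) p i j|].
  apply: contrapT => np; apply: nex; exists n.+1%:R => // p pr pM i j.
  by rewrite leNgt; apply/negP => h; apply: np; exists p; split=> //; exists i, j.
have [u uP] := choice bad.
have [U [UU oU]] := ultra_eventually.
have [p up] : exists p : 'cV[R]_(m + l), u @ U --> p.
  by apply: (@bounded_ultra_cvg _ _ _ _ _ _ r) => n; have [] := uP n.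
have gup : g (u n) @[n --> U] --> g p by exact: continuous_comp_seq.
have gp : edom g p.
  have : (g p <= M%:E)%E.
    by apply: (cvge_to_le gup); apply: nearW => n; have [] := uP n.
  by move=> /le_lt_trans; apply; rewrite ltry.
have [_ _ ch] := g2 gp.
have hup : hess (fine \o g) (u n) @[n --> U] --> hess (fine \o g) p.
  exact: continuous_cvg.
move/cvgrPdist_le : hup => /(_ 1 ltr01) h1.
have B0 : 0 < (`|hess (fine \o g) p| + 1)^-1 by rewrite invr_gt0 ltr_wpDl.
have [n [n1 n2]] := filter_ex (filterI h1 (near_natSinv oU B0)).
have [_ _ [i [j hn]]] := uP n.
have : n.+1%:R < `|hess (fine \o g) p| + 1.
  apply: (lt_le_trans hn); apply: (le_trans (mx_coord_le_norm _ _ _)).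
  rewrite -[hess _ (u n)](subKr (hess (fine \o g) p)).
  by rewrite (le_trans (ler_normB _ _))// lerD.
by rewrite ltNge -[leLHS]invrK -[leRHS]invrK lef_pV2 ?posrE ?invr_gt0 ?(ltW n2)// ltr_wpDl.
Qed.
Lemma grad_coord_derive p (d : 'cV[R]_(m + l)) i :
  edom g p -> is_derive p d (fun w => grad (fine \o g) w i 0)
                (\sum_j hess (fine \o g) p i j * d j 0).
Proof.
move=> gp; have [_ dg _] := g2 gp.
have dgi : differentiable (fun w => grad (fine \o g) w i 0) p.
  exact: (differentiable_comp dg (differentiable_coord _ _ _)).
have := differentiable_is_derive d dgi; rewrite dotvE.
congr (is_derive _ _ _ _); apply: eq_bigr => j _; congr (_ * _).
rewrite !mxE; congr ('D_ _ _ _); apply/funext => w.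
by rewrite mxE.
Qed.

(** Mean value theorem for each coordinate of the gradient; convexity keeps the segment inside the
    bounded sublevel set on which the Hessian is bounded. *)
Lemma grad_y_lipschitz (z : 'cV[R]_l) (r M : R) :
  econvex (fun y => g (col_mx y z)) -> exists2 L, 0 < L & forall y1 y2,
    enorm y1 <= r -> enorm y2 <= r ->
    (g (col_mx y1 z) <= M%:E)%E -> (g (col_mx y2 z) <= M%:E)%E ->
    enorm (grad_y g y1 z - grad_y g y2 z) <= L * enorm (y1 - y2).
Proof.
move=> gz; have [B B0 hB] := hess_bounded (r + enorm z) M.
pose N : R := (m + l).+1%:R; have N0 : 0 < N by [].
(* One [N] comes from summing a row of the Hessian, the other from passing from the sup norm to the
   Euclidean norm. *)
exists (N * (N * B)); first by rewrite !mulr_gt0.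
move=> y1 y2 y1r y2r y1M y2M.
pose q := col_mx y2 z; pose d := col_mx (y1 - y2) (0 : 'cV[R]_l).
have pE (t : R) : t *: d + q = col_mx (t *: y1 + (1 - t) *: y2) z.
  rewrite /d /q scale_col_mx add_col_mx scaler0 add0r; congr col_mx.
  by rewrite scalerBr scalerBl scale1r addrA addrAC -addrA [- _ + _]addrC addrA addrAC.
have pM (t : R) : 0 <= t <= 1 -> (g (t *: d + q) <= M%:E)%E.
  move=> t01; rewrite pE; apply: (le_trans (gz t y1 y2 t01)).
  case/andP: t01 => t0 t1.
  rewrite (_ : M%:E = t%:E * M%:E + (1 - t)%:E * M%:E)%E; last first.
    by rewrite -!EFinM -EFinD -mulrDl addrC subrK mul1r.
  by apply: leeD; apply: lee_wpmul2l; rewrite // lee_fin// subr_ge0.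
have pr (t : R) : 0 <= t <= 1 -> enorm (t *: d + q) <= r + enorm z.
  move=> /andP[t0 t1]; rewrite pE (le_trans (enorm_col_mx_le _ _))// lerD2r.
  rewrite (le_trans (enormD _ _))// !enormZ !ger0_norm ?subr_ge0//.
  rewrite (_ : r = t * r + (1 - t) * r); last by ring.
  by rewrite lerD// ler_wpM2l// subr_ge0.
have gd (t : R) : 0 <= t <= 1 -> edom g (t *: d + q).
  by move=> /pM /le_lt_trans; apply; rewrite ltry.
have dn : enorm d <= enorm (y1 - y2).
  by rewrite (le_trans (enorm_col_mx_le _ _))// enorm0 addr0.
have coord i : `|grad (fine \o g) (col_mx y1 z) i 0 -
                 grad (fine \o g) (col_mx y2 z) i 0| <= N * B * enorm (y1 - y2).
  have q1 : col_mx y1 z = (1 : R) *: d + q by rewrite pE subrr scale0r addr0 scale1r.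
  have q0 : col_mx y2 z = (0 : R) *: d + q by rewrite scale0r add0r.
  pose phi (t : R) : R := grad (fine \o g) (t *: d + q) i 0.
  pose dphi (t : R) : R := \sum_j hess (fine \o g) (t *: d + q) i j * d j 0.
  have dphiP (t : R) : 0 <= t <= 1 -> is_derive t (1 : R) phi (dphi t).
    move=> /gd gt; exact: (is_derive_line (grad_coord_derive d i gt)).
  have [t||c c01 E] := @MVT_segment R phi dphi 0 1 ler01.
  - by rewrite in_itv /= => /andP[t0 t1]; apply: dphiP; rewrite !ltW.
  - apply: derivable_within_continuous => t; rewrite in_itv /= => /dphiP[].
    by [].
  rewrite q1 q0 -/(phi 1) -/(phi 0) E subr0 mulr1 /dphi.
  apply: (le_trans (ler_norm_sum _ _ _)).
  rewrite (@le_trans _ _ (\sum_(j < m + l) B * enorm (y1 - y2)))//.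
    apply: ler_sum => j _; rewrite normrM ler_pM//.
      by apply: hB; rewrite ?pr ?pM//; move: c01; rewrite in_itv.
    exact: le_trans (coord_le_norm _ _) (le_trans (norm_le_enorm _) dn).
  rewrite sumr_const card_ord -[leLHS]mulr_natl -mulrA ler_wpM2r//.
    by rewrite mulr_ge0 ?enorm_ge0 ?ltW.
  by rewrite ler_nat.
rewrite !grad_yE -linearB (le_trans (enorm_usubmx _))//.
rewrite (le_trans (enorm_le_norm _))// -mulrA ler_pM ?ler_nat//.
apply: norm_le_coord => [|i]; first by rewrite !mulr_ge0 ?enorm_ge0 ?ltW.
by have := coord i; rewrite !mxE.
Qed.
End PartialGradients.

(** * Minimizers over Z *)

Section MinimizersInZ.
Context {R : realType} {m l : nat} {g : 'cV[R]_(m + l) -> \bar R}.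
Context {Z : set 'cV[R]_l}.
Hypotheses (g0 : forall p, (0 <= g p)%E) (cg : continuous g).
Hypothesis g2 : C2_in_dom g.
Hypothesis cZ : closed Z.
Hypothesis zreg : forall r M : R, 0 < r -> 0 < M -> z_subproblem_regular g Z r M.

Definition z_argmin (y : 'cV[R]_m) := is_argmin Z (fun w => g (col_mx y w)).

Lemma z_argmin_minimizer y z : z_argmin y z -> z_minimizer g Z y z.
Proof.
move=> [Zz zmin]; split=> // w _; rewrite /iota_set mem_set// adde0.
case: ifPn => [/set_mem/zmin|_]; first by rewrite adde0.
by rewrite addey ?leey// gt_eqF// (lt_le_trans _ (g0 _))// ltNyr.
Qed.

(** The feasible [w] of finite value forces [z] into [Z], since outside [Z] the penalized value is
    +oo. *)
Lemma z_minimizer_argmin y w z :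
  Z w -> edom g (col_mx y w) -> z_minimizer g Z y z -> z_argmin y z.
Proof.
move=> Zw gw [_ zmin].
have Zz : Z z.
  have := zmin w I; rewrite /iota_set (mem_set Zw) adde0.
  case: ifPn => [/set_mem//|_ /le_lt_trans/(_ gw)].
  by rewrite addey ?ltxx// gt_eqF// (lt_le_trans _ (g0 _))// ltNyr.
split=> // v Zv; have := zmin v I.
by rewrite /iota_set (mem_set Zz) (mem_set Zv) !adde0.
Qed.

Lemma level_of_edom y z : Z z -> edom g (col_mx y z) ->
  exists r M : R, [/\ 0 < r, 0 < M & level g Z r M y z].
Proof.
move=> Zz gz; exists (enorm (col_mx y z) + 1), (fine (g (col_mx y z)) + 1).
split; first by rewrite ltr_wpDl ?enorm_ge0.
  by rewrite ltr_wpDl// fine_ge0.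
split=> //; last by rewrite lerDl.
by rewrite [leLHS](edom_fin (g0 _) gz) lee_fin lerDl.
Qed.

Lemma z_argmin_unique y z1 z2 : edom g (col_mx y z1) ->
  z_argmin y z1 -> z_argmin y z2 -> z1 = z2.
Proof.
move=> gz m1 m2; have [Zz _] := m1.
have [r [M [r0 M0 lev]]] := level_of_edom Zz gz.
have [rb [L [/(_ y z1 lev)[[w [_ wu]] _] _]]] := zreg r0 M0.
by rewrite -(wu z1) ?(wu z2)//; exact: z_argmin_minimizer.
Qed.

Lemma zsol_argmin y w : Z w -> edom g (col_mx y w) -> z_argmin y (zsol g Z y).
Proof.
move=> Zw gw; have [r [M [r0 M0 lev]]] := level_of_edom Zw gw.
have [rb [L [/(_ y w lev)[[v [vmin _]] _] _]]] := zreg r0 M0.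
apply: (z_minimizer_argmin Zw gw); rewrite /zsol.
by apply: xgetPex; exists v.
Qed.

Lemma z_argmin_edom y w z : Z w -> edom g (col_mx y w) -> z_argmin y z ->
  edom g (col_mx y z).
Proof. by move=> Zw gw [_ /(_ w Zw) /le_lt_trans]; apply. Qed.

Lemma z_argmin_bounded (r M : R) : exists rb, forall y w z,
  enorm y <= r -> enorm w <= r -> (g (col_mx y w) <= M%:E)%E -> Z w ->
  z_argmin y z -> enorm z <= rb.
Proof.
(* The pair [(y, w)] has norm at most [r + r]; the absolute values and [+ 1] supply the positive
   radius and level that [zreg] asks for. *)
have r0 : 0 < `|r| + `|r| + 1 by rewrite ltr_wpDl.
have M0 : 0 < `|M| + 1 by rewrite ltr_wpDl.
have [rb [L [h _]]] := zreg r0 M0; exists rb => y w z yr wr gM Zw zmin.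
have lev : level g Z (`|r| + `|r| + 1) (`|M| + 1) y w.
  split=> //; first apply: (le_trans gM).
    by rewrite lee_fin (le_trans (ler_norm _))// lerDl.
  rewrite (le_trans (enorm_col_mx_le _ _))// -[leLHS]addr0 lerD// lerD//.
    by rewrite (le_trans yr)// ler_norm.
  by rewrite (le_trans wr)// ler_norm.
have gw : edom g (col_mx y w) by apply: (le_lt_trans gM); rewrite ltry.
have [_ [_ + _]] := h y w lev.
rewrite (z_argmin_unique _ (zsol_argmin Zw gw) zmin); last first.
  exact: z_argmin_edom gw (zsol_argmin Zw gw).
exact: le_trans (enorm_col_mxr _ _).
Qed.

Lemma lee_cvg_to I (F : set_system I) {FF : ProperFilter F} (u v : I -> \bar R)
    (a b : \bar R) : (0 <= b)%E -> u @ F --> a -> v @ F --> b ->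
  (forall i, (u i <= v i)%E) -> (a <= b)%E.
Proof.
move=> b0 ua vb uv; rewrite leNgt; apply/negP => ba.
have [c [bc ca]] : exists c : R, (b < c%:E)%E /\ (c%:E < a)%E.
  have bf : b \is a fin_num by rewrite ge0_fin_numE// (lt_le_trans ba)// leey.
  move: ba; rewrite -(fineK bf); case: a {ua} => [a| |] //=.
    rewrite !lte_fin => ba; exists ((fine b + a) / 2).
    by rewrite !lte_fin; split; lra.
  by move=> _; exists (fine b + 1); rewrite lte_fin ltrDl ltry.
have h1 : \forall i \near F, (c%:E < u i)%E := ua [set x | (c%:E < x)%E] (open_ereal_gt' ca).
have h2 : \forall i \near F, (v i < c%:E)%E := vb [set x | (x < c%:E)%E] (open_ereal_lt' bc).
have [i [/= i1 i2]] := filter_ex (filterI h1 h2).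
by have := lt_trans i1 (le_lt_trans (uv i) i2); rewrite ltxx.
Qed.

(** In the limit of counterexamples [z] is still a minimizer and [w] has the same value, so
    uniqueness gives [z = w]; by continuity both gradients then tend to the same vector. *)
Lemma grad_y_near_argmin (r M e : R) : 0 < e ->
  exists2 d, 0 < d & forall y z w, enorm y <= r -> enorm z <= r ->
    enorm w <= r -> z_argmin y z -> Z w -> (g (col_mx y w) <= M%:E)%E ->
    (g (col_mx y w) <= g (col_mx y z) + d%:E)%E ->
    enorm (grad_y g y z - grad_y g y w) <= e.
Proof.
move=> e0; apply: contrapT => nex.
have bad n : exists t : 'cV[R]_m * 'cV[R]_l * 'cV[R]_l,
    [/\ [/\ enorm t.1.1 <= r, enorm t.1.2 <= r & enorm t.2 <= r],
        z_argmin t.1.1 t.1.2, Z t.2 /\ (g (col_mx t.1.1 t.2) <= M%:E)%E,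
        (g (col_mx t.1.1 t.2) <= g (col_mx t.1.1 t.1.2) + n.+1%:R^-1%:E)%E &
        e < enorm (grad_y g t.1.1 t.1.2 - grad_y g t.1.1 t.2)].
  apply: contrapT => nt; apply: nex; exists n.+1%:R^-1 => // y z w yr zr wr.
  move=> zm Zw gM gd; rewrite leNgt; apply/negP => h; apply: nt.
  by exists (y, z, w).
have [t tP] := choice bad.
have [U [UU oU]] := ultra_eventually.
have [y yU] : exists y : 'cV[R]_m, (fun n => (t n).1.1) @ U --> y.
  by apply: (@bounded_ultra_cvg _ _ _ _ _ _ r) => n; have [[]] := tP n.
have [z zU] : exists z : 'cV[R]_l, (fun n => (t n).1.2) @ U --> z.
  by apply: (@bounded_ultra_cvg _ _ _ _ _ _ r) => n; have [[]] := tP n.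
have [w wU] : exists w : 'cV[R]_l, (fun n => (t n).2) @ U --> w.
  by apply: (@bounded_ultra_cvg _ _ _ _ _ _ r) => n; have [[]] := tP n.
have gzU : g (col_mx (t n).1.1 (t n).1.2) @[n --> U] --> g (col_mx y z).
  by apply: continuous_comp_seq => //; exact: cvg_col_mx.
have gwU : g (col_mx (t n).1.1 (t n).2) @[n --> U] --> g (col_mx y w).
  by apply: continuous_comp_seq => //; exact: cvg_col_mx.
have Zw : Z w by apply: (closed_cvg_mem cZ _ wU) => n; have [_ _ []] := tP n.
have Zz : Z z.
  by apply: (closed_cvg_mem cZ _ zU) => n; have [_ []] := tP n.
have zmin : z_argmin y z.
  split=> // v Zv.
  have gvU : g (col_mx (t n).1.1 v) @[n --> U] --> g (col_mx y v).
    by apply: continuous_comp_seq => //; apply: cvg_col_mx => //; exact: cvg_cst.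
  apply: (lee_cvg_to _ gzU gvU) => // n.
  by have [_ [_ /(_ v Zv)]] := tP n.
have gwM : (g (col_mx y w) <= M%:E)%E.
  by apply: (cvge_to_le gwU); apply: nearW => n; have [_ _ []] := tP n.
have gw : edom g (col_mx y w) by apply: (le_lt_trans gwM); rewrite ltry.
have gz : edom g (col_mx y z) := z_argmin_edom Zw gw zmin.
have wz : (g (col_mx y w) <= g (col_mx y z))%E.
  apply/lee_addgt0Pr => x x0; have x2 : 0 < x / 2 by rewrite divr_gt0.
  have h1 : \forall n \near U, (g (col_mx (t n).1.1 (t n).1.2) <
      (fine (g (col_mx y z)) + x / 2)%:E)%E.
    apply: (gzU [set u | (u < (fine (g (col_mx y z)) + x / 2)%:E)%E]).
    by apply: open_ereal_lt'; rewrite [ltLHS](edom_fin (g0 _) gz) lte_fin ltrDl.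
  have h2 : \forall n \near U, n.+1%:R^-1 < x / 2 by exact: near_natSinv.
  apply: (cvge_to_le gwU); apply: filterS2 h1 h2 => n n1 n2.
  have [_ _ _ h _] := tP n; apply: (le_trans h).
  rewrite [in leRHS](edom_fin (g0 _) gz) -EFinD [x]splitr addrA EFinD.
  by apply: leeD; [exact: ltW | rewrite lee_fin ltW].
have zw : z = w.
  apply: (z_argmin_unique gz zmin); split=> // v Zv; apply: (le_trans wz).
  by have [_] := zmin; apply.
have h1 : grad_y g (t n).1.1 (t n).1.2 @[n --> U] --> grad_y g y w.
  by apply: grad_y_cvg => //; rewrite -zw.
have h2 : grad_y g (t n).1.1 (t n).2 @[n --> U] --> grad_y g y w.
  exact: grad_y_cvg.
have e2 : 0 < e / 2 by rewrite divr_gt0.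
move/cvg_enormP : h1 => /(_ _ e2) h1; move/cvg_enormP : h2 => /(_ _ e2) h2.
have [n [n1 n2]] := filter_ex (filterI h1 h2).
have [_ _ _ _] := tP n; apply/negP; rewrite -leNgt [leRHS]splitr.
have := enormD (grad_y g (t n).1.1 (t n).1.2 - grad_y g y w)
  (grad_y g y w - grad_y g (t n).1.1 (t n).2).
rewrite addrA subrK => /le_trans; apply; apply: lerD; first exact: n1.
by rewrite enormB; exact: n2.
Qed.

End MinimizersInZ.

Arguments z_argmin {R m l} g Z y _.

(** * Minimizing a function plus a quadratic *)

Section Subproblems.
Context {R : realType}.

Lemma near_enorm p (v : 'cV[R]_p) (e : R) : 0 < e ->
  \forall u \near v, enorm (u - v) <= e.
Proof.
move=> e0; apply/nbhs_ballP; exists (e / p.+1%:R); first by rewrite /= divr_gt0.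
move=> u; rewrite -ball_normE /= distrC => /ltW uv.
rewrite (le_trans (enorm_le_norm _))// (le_trans (ler_wpM2l _ uv))//.
by rewrite mulrCA ger_pMr// ler_pdivrMr// mul1r ler_nat.
Qed.

Lemma lipschitz_continuous p (q : 'cV[R]_p -> R) (K : R) : 0 < K ->
  (forall u v, `|q u - q v| <= K * enorm (u - v)) -> continuous q.
Proof.
move=> K0 qK v.
apply/(@cvgrPdist_le _ _ _ (nbhs (v : 'cV[R]_p)) (nbhs_filter _)) => e e0.
have /(near_enorm v) : 0 < e / K by rewrite divr_gt0.
apply: (@filterS _ _ (nbhs_filter v)) => u uv; rewrite (le_trans (qK _ _))// enormB mulrC.
by rewrite -ler_pdivlMr.
Qed.

Lemma enorm_affine_continuous p k (B : 'M[R]_(k, p)) (b : 'cV[R]_k) :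
  continuous (fun v => enorm (B *m v - b)).
Proof.
have [a a0 Ba] := mulmx_bound B; apply: (lipschitz_continuous a0) => u v.
apply: le_trans (Ba _); rewrite mulmxBr.
have E : (B *m u - b) - (B *m v - b) = B *m u - B *m v.
  by rewrite opprB addrA subrK.
rewrite -E; move: (B *m u - b) (B *m v - b) => s t.
rewrite ler_norml lerNl opprB !lerBlDr (enormB s t); apply/andP; split.
  by have := enormD (t - s) s; rewrite subrK.
by rewrite -(enormB s t); have := enormD (s - t) t; rewrite subrK.
Qed.

Lemma dotv_affine_continuous p k (lam : 'cV[R]_k) (B : 'M[R]_(k, p)) (b : 'cV[R]_k) :
  continuous (fun v => dotv lam (B *m v - b)).
Proof.
have [a a0 Ba] := mulmx_bound B.
have K0 : 0 < (enorm lam + 1) * a by rewrite mulr_gt0// ltr_wpDl ?enorm_ge0.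
apply: (lipschitz_continuous K0) => u v; rewrite -mulrA.
have h w : dotv lam (B *m w) <= (enorm lam + 1) * (a * enorm w).
  rewrite (le_trans (dotv_le _ _))// ler_pM ?enorm_ge0//.
  by rewrite lerDl.
have E : dotv lam (B *m u - b) - dotv lam (B *m v - b) = dotv lam (B *m (u - v)).
  by rewrite mulmxBr !dotvLin; lra.
rewrite E ler_norml h andbT lerNl -dotvNr -mulmxN -(enormN (u - v)).
exact: h.
Qed.

(** Common form of the x-step and the y-step: one extended-valued term plus a real-valued rest. A
    comparison point in the domain makes the minimum finite, and what follows is real arithmetic. *)
Lemma argmin_add p (h : 'cV[R]_p -> \bar R) (q : 'cV[R]_p -> R) F x w :
  (forall v, (0 <= h v)%E) -> (forall v, F v = (h v + (q v)%:E)%E) ->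
  is_argmin setT F x -> edom h w ->
  edom h x /\ fine (h x) + q x <= fine (h w) + q w.
Proof.
move=> h0 FE [_ /(_ w I)]; rewrite !FE => le hw.
have hx : edom h x.
  rewrite /edom /= ltey; apply/eqP => hx; move: le.
  rewrite hx addye// leye_eq (edom_fin (h0 w) hw) -EFinD; exact/negP.
by split=> //; move: le; rewrite (edom_fin (h0 x) hx) (edom_fin (h0 w) hw).
Qed.

Lemma cvge_addEFin I (F : set_system I) {FF : Filter F} (a : I -> \bar R)
    (b : I -> R) (la : \bar R) (lb : R) :
  a @ F --> la -> b @ F --> lb -> (a i + (b i)%:E)%E @[i --> F] --> (la + lb%:E)%E.
Proof.
move=> h1 bl; have h2 : (b i)%:E @[i --> F] --> lb%:E.
  by apply: cvg_EFin; [exact: nearW | exact: bl].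
have h3 : (la +? lb%:E)%E by rewrite fin_num_adde_defl.
exact: (cvgeD h3 h1 h2).
Qed.

Lemma argmin_add_exists p (h : 'cV[R]_p -> \bar R) (q : 'cV[R]_p -> R) F (c : R) :
  (forall v, (0 <= h v)%E) -> continuous h -> continuous q ->
  (forall v, c <= q v) -> (forall v, F v = (h v + (q v)%:E)%E) -> coercive F ->
  exists x, is_argmin setT F x.
Proof.
move=> h0 ch cq qc FE coF.
have -> : F = (fun v => h v + (q v)%:E)%E by exact/funext.
have cF : continuous (fun v => h v + (q v)%:E)%E.
  by move=> v; exact: (cvge_addEFin (FF := nbhs_filter _) (ch v) (cq v)).
apply: (@coercive_argmin _ _ _ c) cF _ => [v|].
  by rewrite -[leLHS]add0e; apply: leeD => //; rewrite lee_fin.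
by rewrite (_ : (fun _ => _) = F)//; exact/funext.
Qed.

Lemma coercive_quadratic p (F : 'cV[R]_p -> \bar R) (v0 : 'cV[R]_p) (b c : R) :
  0 < b -> (forall v, ((c + b * enorm (v - v0) ^+ 2)%:E <= F v)%E) -> coercive F.
Proof.
(* With [K >= 1] a distance of at least [K] has a square of at least [K], and [b * K] exceeds
   [M - c]. *)
move=> b0 Fb M; pose K := 1 + `|M - c| / b.
have K1 : 1 <= K by rewrite lerDl divr_ge0// ltW.
exists (enorm v0 + K) => v vK; apply: le_trans (Fb v); rewrite lee_fin.
have Kv : K <= enorm (v - v0).
  have := enormD (v - v0) v0; rewrite subrK; lra.
have : b * K <= b * enorm (v - v0) ^+ 2.
  rewrite ler_wpM2l ?(ltW b0)// expr2 (le_trans Kv)// ler_peMl ?enorm_ge0//.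
  exact: le_trans Kv.
have -> : b * K = b + `|M - c| by rewrite /K mulrDr mulr1 mulrC divfK ?gt_eqF.
have := ler_norm (M - c); lra.
Qed.

(** Completing the square: [beta *: r + lam] has nonnegative square norm. *)
Lemma quadratic_lower_bound p (beta : R) (lam r : 'cV[R]_p) : 0 < beta ->
  - (dotv lam lam / (2 * beta)) <= beta / 2 * enorm r ^+ 2 + dotv lam r.
Proof.
move=> b0; have := dotvv_ge0 (beta *: r + lam).
rewrite !dotvLin enorm_sqr (dotvC r lam) => h.
have E : dotv lam lam / (2 * beta) * (2 * beta) = dotv lam lam.
  by rewrite divfK// gt_eqF// mulr_gt0.
rewrite -subr_ge0 -(pmulr_rge0 _ b0); move: E h.
set d := dotv lam lam / _; set a := dotv lam lam.
set b := dotv _ _; set c := dotv _ _ => E h; nra.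
Qed.

Lemma cvg_quadratic I (F : set_system I) {FF : Filter F} (u v w : I -> R)
    (a b c x y z : R) : u @ F --> x -> v @ F --> y -> w @ F --> z ->
  a + (b * u i ^+ 2 + v i) + c * w i ^+ 2 @[i --> F] -->
  a + (b * x ^+ 2 + y) + c * z ^+ 2.
Proof.
move=> ux vy wz; apply: cvgD; last by apply: cvgMr; rewrite !expr2; exact: cvgM.
apply: cvgD; first exact: cvg_cst.
by apply: cvgD => //; apply: cvgMr; rewrite !expr2; exact: cvgM.
Qed.

Lemma quadratic_continuous p k (a b c : R) (B : 'M[R]_(k, p)) (d lam : 'cV[R]_k)
    (x : 'cV[R]_p) : continuous (fun w =>
  a + (b * enorm (B *m w - d) ^+ 2 + dotv lam (B *m w - d)) + c * enorm (w - x) ^+ 2).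
Proof.
have cx := @enorm_affine_continuous _ _ 1%:M x.
have cB := @enorm_affine_continuous _ _ B d.
have cl := @dotv_affine_continuous _ _ lam B d.
rewrite (_ : (fun w => _) = (fun w => a + (b * enorm (B *m w - d) ^+ 2 +
    dotv lam (B *m w - d)) + c * enorm (1%:M *m w - x) ^+ 2)).
  move=> w.
  have h := @cvg_quadratic _ _ (nbhs_filter w) _ _ _ a b c _ _ _ (cB w) (cl w) (cx w).
  exact: h.
by apply/funext => w; rewrite mul1mx.
Qed.

End Subproblems.

(** * One x-step and one y-step: existence, optimality conditions, descent *)

Section ADMMStep.
Context {R : realType} {n m l : nat}.
Context {f : 'cV[R]_n -> \bar R} {g : 'cV[R]_(m + l) -> \bar R}.
Context {A : 'M[R]_(m, n)} {z : 'cV[R]_l}.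
Let h := fun y => g (col_mx y z).
Hypotheses (cf : convex_smooth f) (ch : convex_smooth h).

Definition x_step (b bx : R) (x : 'cV[R]_n) (y lam : 'cV[R]_m) :=
  is_argmin setT (fun x' => aug_lagrangian f g A b x' y z lam +
    (bx / 2 * enorm (x' - x) ^+ 2)%R%:E)%E.

Definition y_step (b by_ : R) (x' : 'cV[R]_n) (y lam : 'cV[R]_m) :=
  is_argmin setT (fun y' => aug_lagrangian f g A b x' y' z lam +
    (by_ / 2 * enorm (y' - y) ^+ 2)%R%:E)%E.

Section Facts.
Variables (b bx by_ : R) (x x' : 'cV[R]_n) (y y' lam : 'cV[R]_m).
Hypotheses (b0 : 0 < b) (bx0 : 0 <= bx) (by0 : 0 < by_).
Hypotheses (hf : edom f x) (hh : edom h y).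

Let qx w := fine (h y) + (b / 2 * enorm (A *m w - y) ^+ 2 + dotv lam (A *m w - y))
  + bx / 2 * enorm (w - x) ^+ 2.

Let xE w : (aug_lagrangian f g A b w y z lam +
    (bx / 2 * enorm (w - x) ^+ 2)%:E = f w + (qx w)%:E)%E.
Proof.
rewrite /aug_lagrangian -/(h y) (edom_fin (cs_ge0 ch y) hh) -!addeA -!EFinD.
by rewrite /qx addrA.
Qed.

(** All terms are bounded below once the square in [A *m w - y] is completed, so coercivity comes
    either from the proximal term or, if [bx] vanishes, from [f]. *)
Lemma x_step_exists : coercive f \/ 0 < bx -> (bx = 0 -> forall w : 'cV[R]_n, A *m w = 0) ->
  exists w, x_step b bx x y lam w.
Proof.
move=> cof bxA; have h0 := fine_ge0 (cs_ge0 ch y).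
have qb w : - (dotv lam lam / (2 * b)) + bx / 2 * enorm (w - x) ^+ 2 <= qx w.
  have := quadratic_lower_bound lam (A *m w - y) b0.
  rewrite /qx; move: h0; set u := fine _; set v := _ * _ ^+ 2; lra.
have qc : continuous qx by exact: quadratic_continuous.
apply: (argmin_add_exists (c := - (dotv lam lam / (2 * b)))
  (cs_ge0 cf) (cs_continuous cf) qc _ xE).
  move=> w; apply: le_trans (qb w); rewrite lerDl mulr_ge0 ?sqr_ge0//.
  by rewrite divr_ge0.
have Flow w : ((- (dotv lam lam / (2 * b)) + bx / 2 * enorm (w - x) ^+ 2)%:E <= f w + (qx w)%:E)%E.
  rewrite -[leLHS]add0e; apply: leeD; first exact: cs_ge0 cf _.
  by rewrite lee_fin.
have [bxp|bxn] := ltP 0 bx.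
  apply: (@coercive_quadratic _ _ _ x (bx / 2)) => [|w]; first by rewrite divr_gt0.
  by rewrite xE; exact: Flow.
have [cof'|] := cof; last by rewrite ltNge bxn.
move=> M; have [r rP] := cof' (M + dotv lam lam / (2 * b)); exists r => v /rP fv.
rewrite xE; apply: (@le_trans _ _ ((M + dotv lam lam / (2 * b))%:E + (qx v)%:E)%E).
  rewrite -EFinD lee_fin; have := qb v.
  have : 0 <= bx / 2 * enorm (v - x) ^+ 2 by rewrite mulr_ge0 ?sqr_ge0// divr_ge0.
  lra.
exact: leeD.
Qed.

Hypotheses (xs : x_step b bx x y lam x') (ys : y_step b by_ x' y lam y').

Lemma x_step_edom : edom f x'.
Proof. by have [] := argmin_add (cs_ge0 cf) xE xs hf. Qed.

Let qy w := fine (f x') + (b / 2 * enorm (A *m x' - w) ^+ 2 + dotv lam (A *m x' - w))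
  + by_ / 2 * enorm (w - y) ^+ 2.

Let yE w : (aug_lagrangian f g A b x' w z lam +
    (by_ / 2 * enorm (w - y) ^+ 2)%:E = h w + (qy w)%:E)%E.
Proof.
rewrite /aug_lagrangian -/(h w) (edom_fin (cs_ge0 cf x') x_step_edom).
by rewrite [(_ + h w)%E]addeC -!addeA -!EFinD /qy addrA.
Qed.

Lemma y_step_edom : edom h y'.
Proof. by have [] := argmin_add (cs_ge0 ch) yE ys hh. Qed.

Let lam' := lam + b *: (A *m x' - y').

(** The multiplier seen by the x-step, [lam + b *: (A *m x' - y)], is the updated one plus
    [b *: (y' - y)]. *)
Lemma x_step_gradient : grad (fine \o f) x' =
  - (A^T *m (lam' + b *: (y' - y)) + bx *: (x' - x)).
Proof.
have [a a0 Aa] := mulmx_bound A.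
apply: (@quadratic_fermat _ _ _ cf _ _ (b / 2 * a ^+ 2 + bx / 2) x_step_edom) => w hw.
have [_] := argmin_add (cs_ge0 cf) xE xs hw.
have -> : lam' + b *: (y' - y) = lam + b *: (A *m x' - y).
  by rewrite /lam' -addrA -scalerDr addrA subrK.
have -> : w = (w - x') + x' by rewrite subrK.
rewrite addrK; move: (w - x') => d.
have Ad : b / 2 * dotv (A *m d) (A *m d) <= b / 2 * a ^+ 2 * dotv d d.
  have -> : b / 2 * a ^+ 2 * dotv d d = b / 2 * (a * enorm d) ^+ 2.
    rewrite exprMn enorm_sqr; ring.
  rewrite -enorm_sqr ler_pM2l ?divr_gt0// ler_sqr ?nnegrE ?enorm_ge0//.
  by rewrite mulr_ge0 ?enorm_ge0 ?(ltW a0).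
rewrite /qx mulmxDr -!addrA !enorm_sqr.
move: (A *m x' - y) (x' - x) => r s.
rewrite !dotvLin -!dotv_mulmx (dotvC (A *m d) r) (dotvC s d).
rewrite !dotvLin; move: Ad; lra.
Qed.

(** Read backwards, this expresses the new multiplier by the gradient at [y'] and the last increment
    of [y]; both Lyapunov arguments rest on it. *)
Lemma y_step_gradient : grad (fine \o h) y' = lam' - by_ *: (y' - y).
Proof.
rewrite -[RHS]opprK.
apply: (@quadratic_fermat _ _ _ ch _ _ (b / 2 + by_ / 2) y_step_edom) => w hw.
have [_] := argmin_add (cs_ge0 ch) yE ys hw.
have -> : w = (w - y') + y' by rewrite subrK.
rewrite addrK; move: (w - y') => d.
rewrite /qy /lam' !enorm_sqr; move: (A *m x') => u.
rewrite !dotvLin (dotvC y' u) (dotvC d u) (dotvC y' d) (dotvC y d) (dotvC y y').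
by lra.
Qed.

Lemma step_descent :
  fine (f x') + fine (h y') + b / 2 * dotv (A *m x' - y') (A *m x' - y')
    + dotv lam (A *m x' - y') + bx / 2 * dotv (x' - x) (x' - x)
    + by_ / 2 * dotv (y' - y) (y' - y)
  <= fine (f x) + fine (h y) + b / 2 * dotv (A *m x - y) (A *m x - y)
    + dotv lam (A *m x - y).
Proof.
have [_] := argmin_add (cs_ge0 cf) xE xs hf.
have [_] := argmin_add (cs_ge0 ch) yE ys hh.
by rewrite /qx /qy !subrr !enorm0 !enorm_sqr expr0n /=; lra.
Qed.

Lemma y_step_exists : exists w, y_step b by_ x' y lam w.
Proof.
have f0 := fine_ge0 (cs_ge0 cf x').
have qb w : - (dotv lam lam / (2 * b)) + by_ / 2 * enorm (w - y) ^+ 2 <= qy w.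
  have := quadratic_lower_bound lam (A *m x' - w) b0.
  by rewrite /qy; move: f0; set u := fine _; set v := _ * _ ^+ 2; lra.
have qc : continuous qy.
  have -> : qy = fun w => fine (f x') + (b / 2 * enorm (- 1%:M *m w - - (A *m x')) ^+ 2
      + dotv lam (- 1%:M *m w - - (A *m x'))) + by_ / 2 * enorm (w - y) ^+ 2.
    by apply/funext => w; rewrite /qy mulNmx mul1mx opprK addrC [- w + _]addrC [RHS]addrC.
  exact: quadratic_continuous.
apply: (argmin_add_exists (c := - (dotv lam lam / (2 * b)))
  (cs_ge0 ch) (cs_continuous ch) qc _ yE).
  move=> w; apply: le_trans (qb w); rewrite lerDl mulr_ge0 ?sqr_ge0//.
  by rewrite divr_ge0// ltW.
apply: (@coercive_quadratic _ _ _ y (by_ / 2)) => [|w]; first by rewrite divr_gt0.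
rewrite yE -[leLHS]add0e; apply: leeD; first exact: cs_ge0 ch _.
by rewrite lee_fin; exact: qb.
Qed.

End Facts.
End ADMMStep.

Arguments x_step {R n m l} f g A z b bx x y lam _.
Arguments y_step {R n m l} f g A z b by_ x' y lam _.

(** * Convex ADMM with fixed penalties *)

Section SaddleLyapunov.
Context {R : realType} {n m l : nat}.
Context {f : 'cV[R]_n -> \bar R} {g : 'cV[R]_(m + l) -> \bar R}.
Context {A : 'M[R]_(m, n)} {z : 'cV[R]_l}.
Let h := fun y => g (col_mx y z).
Hypotheses (cf : convex_smooth f) (ch : convex_smooth h).

(** If the sum [d] of the gradients were nonzero at a minimizer, a short step along [- d] would
    decrease the objective, by the Frechet expansions of [f] and [h]. *)
Lemma kkt_point : coercive (fun x => f x + h (A *m x))%E ->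
  (exists x, edom f x /\ edom h (A *m x)) ->
  exists x, [/\ edom f x, edom h (A *m x) &
    grad (fine \o f) x = - (A^T *m grad (fine \o h) (A *m x))].
Proof.
move=> coF [x1 [fx1 hx1]].
have cA : continuous (fun x : 'cV[R]_n => A *m x).
  move=> x; have hid : (fun u : 'cV[R]_n => u) @ (x : 'cV[R]_n) --> (x : 'cV[R]_n).
    exact: cvg_id.
  exact: (@cvg_mulmx _ _ _ (nbhs_pfilter _) _ _ A _ _ hid).
have F0 v : (0%:E <= f v + h (A *m v))%E by rewrite adde_ge0 ?(cs_ge0 cf) ?(cs_ge0 ch).
have cF : continuous (fun x => f x + h (A *m x))%E.
  move=> x; have hA : h (A *m u) @[u --> (x : 'cV[R]_n)] --> h (A *m x).
    exact: (continuous_comp (cA x) (cs_continuous ch (x := A *m x))).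
  have d : (f x +? h (A *m x))%E.
    by rewrite ge0_adde_def ?inE ?(cs_ge0 cf) ?(cs_ge0 ch).
  exact: (cvgeD d (cs_continuous cf (x := x)) hA).
have [x [_ xmin]] := coercive_argmin F0 cF coF.
have Fx : (f x + h (A *m x) < +oo)%E.
  by apply: (le_lt_trans (xmin x1 I)); rewrite lte_add_pinfty.
have fx : edom f x.
  by apply: le_lt_trans Fx; rewrite leeDl// (cs_ge0 ch).
have hx : edom h (A *m x).
  by apply: le_lt_trans Fx; rewrite leeDr// (cs_ge0 cf).
exists x; split=> //.
pose d := grad (fine \o f) x + A^T *m grad (fine \o h) (A *m x).
suff : d = 0 by move=> /eqP; rewrite addr_eq0 => /eqP.
apply/eqP; rewrite -normr_le0 (le_trans (norm_le_enorm _))// leNgt; apply/negP => dp.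
have [a a0 Aa] := mulmx_bound A.
have a1 : 0 < 1 + a by rewrite addr_gt0.
(* The remainders [e * r] and [e * (a * r)] together use up half of the first-order decrease
   [t * enorm d ^+ 2]. *)
pose e := enorm d / (2 * (1 + a)).
have e0 : 0 < e by rewrite divr_gt0// mulr_gt0.
have [r1 r10 hr1] := cs_frechet cf fx e0.
have [r2 r20 hr2] := cs_frechet ch hx e0.
have [r3 r30 hr3] := edom_open (cs_ge0 cf) (cs_continuous cf) fx.
have [r4 r40 hr4] := edom_open (cs_ge0 ch) (cs_continuous ch) hx.
pose r := Num.min (Num.min r1 r3) (Num.min r2 r4 / a).
have r0 : 0 < r by rewrite !lt_min r10 r30 divr_gt0// lt_min r20.
pose t := r / enorm d.
have t0 : 0 < t by rewrite divr_gt0.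
pose w := x - t *: d.
have wE : w - x = - (t *: d) by rewrite /w addrC addKr.
have AwE : A *m w - A *m x = - (t *: (A *m d)).
  by rewrite -mulmxBr wE mulmxN -scalemxAr.
have tr : t * enorm d = r by rewrite divfK// gt_eqF.
have wn : enorm (w - x) = r by rewrite wE enormN enormZ gtr0_norm.
have Awn : enorm (A *m w - A *m x) <= a * r.
  by rewrite -mulmxBr (le_trans (Aa _))// wn.
have ar : a * r <= Num.min r2 r4.
  by rewrite mulrC -ler_pdivlMr// /r ge_min lexx orbT.
have wr : r <= Num.min r1 r3 by rewrite /r ge_min lexx.
have fw : edom f w by apply: hr3; rewrite wn (le_trans wr)// ge_min lexx orbT.
have hw : edom h (A *m w).
  by apply: hr4; rewrite (le_trans Awn)// (le_trans ar)// ge_min lexx orbT.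
have := hr1 w; rewrite wn (le_trans wr) ?ge_min ?lexx// => /(_ isT).
have := hr2 (A *m w); rewrite (le_trans Awn) ?(le_trans ar) ?ge_min ?lexx// => /(_ isT).
rewrite wE AwE !dotvNr !dotvZr dotv_mulmx opprK.
have : grad (fine \o f) x = d - A^T *m grad (fine \o h) (A *m x) by rewrite addrK.
move=> ->; rewrite dotvDl dotvNl.
have := xmin w I; rewrite (edom_fin (cs_ge0 cf x) fx) (edom_fin (cs_ge0 cf w) fw).
rewrite (edom_fin (cs_ge0 ch _) hx) (edom_fin (cs_ge0 ch _) hw) -!EFinD lee_fin.
rewrite -enorm_sqr => h1 /ler_normlP[_ h2] /ler_normlP[_ h3].
have h4 : e * enorm (- (t *: (A *m d))) <= e * (a * r).
  by rewrite ler_wpM2l ?(ltW e0)// -AwE.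
have h5 : e * r + e * (a * r) = t * enorm d ^+ 2 / 2.
  rewrite /e -tr; field.
  by rewrite gt_eqF.
have h6 : 0 < t * enorm d ^+ 2 by rewrite mulr_gt0// exprn_gt0.
move: h1 h2 h3 h4 h5 h6 => /=; set k := dotv _ _.
lra.
Qed.

Variables (xo : 'cV[R]_n).
Hypotheses (fxo : edom f xo) (hxo : edom h (A *m xo)).
Let lo := grad (fine \o h) (A *m xo).
Hypothesis kkt : grad (fine \o f) xo = - (A^T *m lo).

Variables (b bx by_ : R).
Hypotheses (b0 : 0 < b) (bx0 : 0 <= bx) (by0 : 0 < by_).

Definition saddle_lyapunov (x : 'cV[R]_n) (y lam : 'cV[R]_m) : R :=
  b^-1 * dotv (lam - lo) (lam - lo) +
  (b + by_) * dotv (y - A *m xo) (y - A *m xo) + bx * dotv (x - xo) (x - xo).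

Section Step.
Variables (x x' : 'cV[R]_n) (y y' lam : 'cV[R]_m).
Hypotheses (hf : edom f x) (hh : edom h y).
Hypothesis xs : x_step f g A z b bx x y lam x'.
Hypothesis ys : y_step f g A z b by_ x' y lam y'.
Let lam' := lam + b *: (A *m x' - y').

(** With r = Ax' - y' and t = y' - y, monotonicity of both gradients between the new iterate and the
    KKT point bounds the cross terms of the difference; what is left over, b |r|^2 + 2 b r.t + b
    |t|^2, is b |Ax' - y|^2. *)
Lemma saddle_lyapunov_decrease :
  saddle_lyapunov x' y' lam' + by_ * dotv (y' - y) (y' - y) +
    bx * dotv (x' - x) (x' - x) + b * dotv (A *m x' - y) (A *m x' - y)
  <= saddle_lyapunov x y lam.
Proof.
have fx' := x_step_edom cf ch hf hh xs.
have hy' := y_step_edom cf ch hf hh xs ys.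
have := gradient_monotone cf fx' fxo.
rewrite (x_step_gradient cf ch y' b0 hf hh xs) kkt.
have := gradient_monotone ch hy' hxo.
rewrite (y_step_gradient cf ch hf hh xs ys) -/lo -/lam' /saddle_lyapunov.
have -> : lam - lo = (lam' - lo) - b *: (A *m x' - y') by rewrite /lam' addrAC addrK.
have -> : x - xo = (x' - xo) - (x' - x) by rewrite opprB [RHS]addrC addrA subrK.
have -> : y - A *m xo = (y' - A *m xo) - (y' - y) by rewrite opprB [RHS]addrC addrA subrK.
have -> : A *m x' - y = (A *m x' - y') + (y' - y) by rewrite addrA subrK.
have -> : lam' - by_ *: (y' - y) - lo = (lam' - lo) - by_ *: (y' - y) by rewrite addrAC.
have -> : - (A^T *m (lam' + b *: (y' - y)) + bx *: (x' - x)) - - (A^T *m lo)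
  = - (A^T *m ((lam' - lo) + b *: (y' - y))) - bx *: (x' - x).
  rewrite opprK opprD addrAC [lam' - lo + _]addrAC mulmxBr opprB.
  by rewrite [- _ + A^T *m lo]addrC.
have : A *m (x' - xo) = (A *m x' - y') + (y' - A *m xo) by rewrite mulmxBr addrA subrK.
move: (lam' - lo) (A *m x' - y') (x' - xo) (x' - x) (y' - A *m xo) (y' - y).
move=> mu r p s q t Ap.
rewrite !dotvLin -dotv_mulmx.
have E2 : b^-1 * (dotv mu mu - b * dotv mu r + (- (b * dotv r mu) - b * - (b * dotv r r)))
    = b^-1 * dotv mu mu - 2 * dotv mu r + b * dotv r r.
  by rewrite (dotvC r mu); field; rewrite gt_eqF.
rewrite E2 Ap !dotvLin (dotvC t r) (dotvC t q) (dotvC s p).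
lra.
Qed.

(** The multiplier cancels between the two optimality conditions, so the gradient part of Theta is
    controlled by increments alone. *)
Lemma step_residual_gradient :
  grad (fine \o f) x' + A^T *m grad (fine \o h) y' =
  - ((b + by_) *: (A^T *m (y' - y)) + bx *: (x' - x)).
Proof.
rewrite (x_step_gradient cf ch y' b0 hf hh xs) (y_step_gradient cf ch hf hh xs ys).
rewrite -/lam' mulmxDr mulmxBr -!scalemxAr scalerDl !opprD.
by rewrite [LHS]addrC addrA; congr (_ - _); rewrite addrACA subrr add0r addrC.
Qed.

End Step.
Section Bounds.
Variables (x : 'cV[R]_n) (y lam : 'cV[R]_m) (C : R).
Hypothesis VC : saddle_lyapunov x y lam <= C.

Let V0 : [/\ 0 <= b^-1 * dotv (lam - lo) (lam - lo),
  0 <= (b + by_) * dotv (y - A *m xo) (y - A *m xo) &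
  0 <= bx * dotv (x - xo) (x - xo)].
Proof.
by split; rewrite mulr_ge0 ?dotvv_ge0 ?invr_ge0 ?addr_ge0// ltW.
Qed.

Lemma saddle_lyapunov_boundy : enorm y <= enorm (A *m xo) + (1 + C / (b + by_)).
Proof.
have [v1 v2 v3] := V0.
rewrite -(subrK (A *m xo) y) (le_trans (enormD _ _))// addrC lerD2l.
apply: le_one_plus_sqr; rewrite ler_pdivlMr ?addr_gt0// mulrC enorm_sqr.
by move: VC v1 v2 v3; rewrite /saddle_lyapunov; lra.
Qed.

Lemma saddle_lyapunov_boundlam : enorm lam <= enorm lo + (1 + C * b).
Proof.
have [v1 v2 v3] := V0.
rewrite -(subrK lo lam) (le_trans (enormD _ _))// addrC lerD2l.
apply: le_one_plus_sqr; rewrite -ler_pdivrMr// mulrC enorm_sqr.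
by move: VC v1 v2 v3; rewrite /saddle_lyapunov; lra.
Qed.

Lemma saddle_lyapunov_boundx : bx * dotv (x - xo) (x - xo) <= C.
Proof.
have [v1 v2 v3] := V0.
by move: VC v1 v2 v3; rewrite /saddle_lyapunov; lra.
Qed.

Lemma saddle_lyapunov_ge0 : 0 <= saddle_lyapunov x y lam.
Proof. by have [v1 v2 v3] := V0; rewrite /saddle_lyapunov; lra. Qed.

End Bounds.

(* [bx] may vanish, so [x'] is only controlled through [bx * |x' - xo|^2]. *)
Lemma saddle_phase (xb : 'cV[R]_n) (C e : R) :
  edom f xb -> edom h (A *m xb) -> 0 <= C -> 0 < e ->
  exists2 d, 0 < d & forall x x' y y' lam, edom f x -> edom h y ->
    x_step f g A z b bx x y lam x' ->
    y_step f g A z b by_ x' y lam y' ->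
    let lam' := lam + b *: (A *m x' - y') in
    saddle_lyapunov x y lam <= C ->
    saddle_lyapunov x y lam - saddle_lyapunov x' y' lam' <= d ->
    [/\ enorm (grad (fine \o f) x' + A^T *m grad (fine \o h) y') <= e,
        enorm (A *m x' - y') <= e &
        fine (f x') + fine (h y') <= fine (f xb) + fine (h (A *m xb)) + e].
Proof.
move=> fxb hxb C0 e0.
have [a a0 Aa] := mulmx_bound A^T.
pose Y := enorm (A *m xb) + (enorm (A *m xo) + (1 + C / (b + by_))).
have Y0 : 0 <= Y by rewrite !addr_ge0 ?enorm_ge0 ?divr_ge0 ?addr_ge0// ltW.
pose L := enorm lo + (1 + C * b).
have L0 : 0 <= L by rewrite !addr_ge0 ?enorm_ge0 ?mulr_ge0// ltW.
pose C2 := 2 * (C + bx * dotv (xb - xo) (xb - xo)).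
have C20 : 0 <= C2 by rewrite mulr_ge0 ?addr_ge0 ?mulr_ge0 ?dotvv_ge0.
(* [T] dominates the coefficient of [e'] in each of the three final estimates. *)
pose T := (b + by_) * a + 1 + L + b * (Y + 1) + by_ * Y + 1.
have T0 : 0 < T.
  have b0' := ltW b0; have by0' := ltW by0; have a0' := ltW a0.
  by rewrite /T; have := mulr_ge0 (addr_ge0 b0' by0') a0'; have := mulr_ge0 by0' Y0;
    have := mulr_ge0 b0' (addr_ge0 Y0 ler01); lra.
pose e' := Num.min 1 (e / T).
have e'0 : 0 < e' by rewrite lt_min ltr01 divr_gt0.
have e'1 : e' <= 1 by rewrite ge_min lexx.
have e'T : e' * T <= e by rewrite -ler_pdivlMr// ge_min lexx orbT.
(* The first two entries make |y' - y| and |Ax' - y| at most [e' / 2]; the last two bound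
   [bx * enorm s] and [bx * (enorm s * enorm w)] by [e']. *)
pose K := Num.min (Num.min (by_ / 4) (b / 4)) (Num.min (bx + 1)^-1 (C2 + 1)^-1).
have K0 : 0 < K by rewrite !lt_min !divr_gt0// !invr_gt0 !ltr_wpDl.
have K1 : K <= by_ / 4 by rewrite !ge_min lexx.
have K2 : K <= b / 4 by rewrite !ge_min lexx !orbT.
have K3 : K * (bx + 1) <= 1.
  by rewrite -ler_pdivlMr ?ltr_wpDl// div1r !ge_min lexx !orbT.
have K4 : K * (C2 + 1) <= 1.
  by rewrite -ler_pdivlMr ?ltr_wpDl// div1r !ge_min lexx !orbT.
exists (e' ^+ 2 * K); first by rewrite mulr_gt0// exprn_gt0.
move=> x x' y y' lam fx hy xs ys lam' VC Vd.
have dec := saddle_lyapunov_decrease fx hy xs ys.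
have fx' := x_step_edom cf ch fx hy xs.
have hy' := y_step_edom cf ch fx hy xs ys.
have VC' : saddle_lyapunov x' y' lam' <= C.
  apply: le_trans VC; move: dec; rewrite -/lam'.
  have := dotvv_ge0 (y' - y); have := dotvv_ge0 (x' - x).
  have := dotvv_ge0 (A *m x' - y); move: b0 bx0 by0.
  set u1 := dotv _ _; set u2 := dotv _ _; set u3 := dotv _ _; nra.
have yY := saddle_lyapunov_boundy VC'.
have lL := saddle_lyapunov_boundlam VC'.
have xC := saddle_lyapunov_boundx VC'.
have res := step_residual_gradient fx hy xs ys.
have gf := gradient_inequality cf fx' fxb.
have gh := gradient_inequality ch hy' hxb.
rewrite (x_step_gradient cf ch y' b0 fx hy xs) -/lam' in gf.
rewrite (y_step_gradient cf ch fx hy xs ys) -/lam' in gh.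
set s := x' - x in res dec gf *; set t := y' - y in res dec gf gh *.
have rtE : A *m x' - y = (A *m x' - y') + t by rewrite addrA subrK.
set r := A *m x' - y' in rtE gh *.
rewrite rtE -/lam' in dec.
set w := xb - x' in gf *.
have wE : w = (xb - xo) - (x' - xo) by rewrite opprB addrA subrK.
have [n1 [n2 n3]] : 0 <= by_ * dotv t t /\ 0 <= bx * dotv s s /\
    0 <= b * dotv (r + t) (r + t).
  by rewrite !mulr_ge0 ?dotvv_ge0// ltW.
have e20 : 0 <= e' ^+ 2 by rewrite sqr_ge0.
have te : enorm t <= e' / 2.
  apply: (small_of_sqr by0); rewrite ?enorm_ge0 ?divr_ge0 ?(ltW e'0)//.
  rewrite enorm_sqr; have := ler_wpM2l e20 K1; lra.
have rte : enorm (r + t) <= e' / 2.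
  apply: (small_of_sqr b0); rewrite ?enorm_ge0 ?divr_ge0 ?(ltW e'0)//.
  rewrite enorm_sqr; have := ler_wpM2l e20 K2; lra.
have re : enorm r <= e'.
  by rewrite -(addrK t r) (le_trans (enormD _ _))// enormN; lra.
have sK : bx * dotv s s <= e' ^+ 2 * K by lra.
have se : bx * enorm s <= e'.
  rewrite -ler_sqr ?nnegrE ?mulr_ge0 ?enorm_ge0 ?(ltW e'0)// exprMn enorm_sqr.
  rewrite expr2 -mulrA (le_trans (ler_wpM2l bx0 sK))//.
  by have := ler_wpM2l e20 K3; have := mulr_ge0 e20 (ltW K0); lra.
have wC : bx * dotv w w <= C2.
  have := mulr_ge0 bx0 (dotvv_ge0 ((xb - xo) + (x' - xo))).
  move: xC; rewrite wE /C2; move: (xb - xo) (x' - xo) => w1 w2.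
  rewrite !dotvLin (dotvC w2 w1); lra.
(* Squaring gives each factor its own [bx], since [w] is bounded only through [bx * dotv w w]. *)
have swe : bx * (enorm s * enorm w) <= e'.
  rewrite -ler_sqr ?nnegrE ?mulr_ge0 ?enorm_ge0 ?(ltW e'0)// !exprMn !enorm_sqr.
  have -> : bx ^+ 2 * (dotv s s * dotv w w) = (bx * dotv s s) * (bx * dotv w w) by ring.
  apply: le_trans (ler_pM _ _ sK wC) _; rewrite ?mulr_ge0 ?dotvv_ge0//.
  by have := ler_wpM2l e20 K4; have := mulr_ge0 e20 (ltW K0); lra.
have e'x u : 0 <= u -> u <= T -> e' * u <= e.
  by move=> u0 uT; rewrite (le_trans _ e'T)// ler_wpM2l// ltW.
have b1 : 0 <= (b + by_) * a by rewrite mulr_ge0 ?addr_ge0 ?(ltW b0) ?(ltW by0) ?(ltW a0).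
have b2 : 0 <= b * (Y + 1) by rewrite mulr_ge0 ?(ltW b0)// addr_ge0.
have b3 : 0 <= by_ * Y by rewrite mulr_ge0// ltW.
split.
- rewrite res enormN (le_trans (enormD _ _))// !enormZ !ger0_norm ?addr_ge0 ?(ltW b0) ?(ltW by0)//.
  apply: (@le_trans _ _ (e' * ((b + by_) * a + 1))).
    have : (b + by_) * enorm (A^T *m t) <= (b + by_) * (a * e').
      rewrite ler_wpM2l ?addr_ge0 ?(ltW b0) ?(ltW by0)// (le_trans (Aa _))//.
      by rewrite ler_wpM2l ?(ltW a0)//; lra.
    lra.
  by apply: e'x; [rewrite addr_ge0 | rewrite /T; lra].
- by apply: (le_trans re); rewrite -[e']mulr1; apply: e'x; rewrite // /T; lra.
(* In the sum of the two gradient inequalities towards [xb], the [lam'] terms cancel except for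
   [- dotv lam' r]. *)
- have Axb : A *m w = (A *m xb - y') - r by rewrite mulmxBr /r opprB addrA subrK.
  have qY : enorm (A *m xb - y') <= Y.
    by rewrite (le_trans (enormD _ _))// enormN lerD2l.
  clearbody lam' w t s r.
  move: Axb gf gh; move: (A *m xb - y') qY => q qY Axb.
  rewrite !dotvLin -dotv_mulmx Axb !dotvLin => gf gh.
  have d1 : - dotv lam' r <= L * e'.
    rewrite -dotvNl (le_trans (dotv_le _ _))// enormN ler_pM ?enorm_ge0//.
  have d2 : dotv t q <= e' / 2 * Y.
    by rewrite (le_trans (dotv_le _ _))// ler_pM ?enorm_ge0.
  have d3 : - dotv t r <= e' / 2 * 1.
    rewrite -dotvNr (le_trans (dotv_le _ _))// enormN ler_pM ?enorm_ge0//.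
    exact: le_trans e'1.
  have d4 : bx * dotv s w <= e'.
    by apply: le_trans swe; rewrite ler_wpM2l// dotv_le.
  have d2b := ler_wpM2l (ltW b0) d2; have d2y := ler_wpM2l (ltW by0) d2.
  have d3b := ler_wpM2l (ltW b0) d3.
  have p1 : 0 <= b * (e' * Y) by rewrite !mulr_ge0// ltW.
  have p2 : 0 <= by_ * (e' * Y) by rewrite !mulr_ge0// ltW.
  have p3 : 0 <= b * e' by rewrite mulr_ge0// ltW.
  have p4 : 0 <= e' * ((b + by_) * a) by rewrite mulr_ge0// ltW.
  move: e'T; rewrite /T; lra.
Qed.
End SaddleLyapunov.

Arguments saddle_lyapunov {R n m l} g A z xo b bx by_ x y lam.

(** * Restarts with large penalties *)

Section Restart.
Context {R : realType} {n m l : nat}.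
Context {f : 'cV[R]_n -> \bar R} {g : 'cV[R]_(m + l) -> \bar R}.
Context {A : 'M[R]_(m, n)} {z : 'cV[R]_l}.
Let h := fun y => g (col_mx y z).
Hypotheses (cf : convex_smooth f) (ch : convex_smooth h).
Hypothesis cg : continuous g.
Hypothesis g2 : C2_in_dom g.
Hypothesis coF : coercive (fun x => f x + h (A *m x))%E.
Variable xb : 'cV[R]_n.
Hypotheses (fxb : edom f xb) (hxb : edom h (A *m xb)).
Let G := grad (fine \o h).
Let M0 := fine (f xb) + fine (h (A *m xb)).

(* Nothing forces [f] or [h] alone to be coercive: a far away nearly feasible
   point is pulled back along the segment to [xb] onto the sphere of radius
   [rho], where it contradicts the coercivity of [f x + h (A x)]. *)
Lemma near_feasible_bounded (M : R) : M0 <= M ->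
  exists d ry : R, 0 < d /\ enorm (A *m xb) <= ry /\ forall x y,
    edom f x -> edom h y -> fine (f x) <= M -> fine (h y) <= M ->
    enorm (A *m x - y) <= d -> enorm y <= ry /\ edom h (A *m x).
Proof.
move=> M0M.
have [a a0 Aa] := mulmx_bound A.
(* On the sphere [f] is at most [M] and [h] at the image at most [M + 1]; their sum stays below this
   level. The radius [rho] makes points of the sphere have norm at least [r0]. *)
have [r0 r0P] := coF (M + M + 2).
pose rho := `|r0| + enorm xb + 1.
have rho0 : 0 < rho by rewrite ltr_wpDl// addr_ge0// enorm_ge0.
pose ry := enorm (A *m xb) + a * rho + 1.
have [d1 d10 d1P] := usc_near_sublevel ry M (cs_ge0 ch) (cs_continuous ch) ltr01.
pose d := Num.min d1 1.
have d0 : 0 < d by rewrite lt_min d10 ltr01.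
have d_le1 : d <= 1 by rewrite ge_min lexx orbT.
have d_led1 : d <= d1 by rewrite ge_min lexx.
have fxb0 := fine_ge0 (cs_ge0 cf xb); have hxb0 := fine_ge0 (cs_ge0 ch (A *m xb)).
have fbM : fine (f xb) <= M by move: M0M; rewrite /M0; lra.
have hbM : fine (h (A *m xb)) <= M by move: M0M; rewrite /M0; lra.
have yb x y : enorm (x - xb) <= rho -> enorm (A *m x - y) <= d -> enorm y <= ry.
  move=> xr xy; have -> : y = A *m xb + A *m (x - xb) - (A *m x - y).
    by rewrite mulmxBr addrC [A *m xb + _]addrC subrK opprB subrK.
  rewrite (le_trans (enormD _ _))// enormN /ry lerD ?(le_trans xy)//.
  rewrite (le_trans (enormD _ _))// lerD2l (le_trans (Aa _))//.
  by rewrite ler_wpM2l// ltW.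
have near x y : enorm (x - xb) <= rho -> edom h y -> fine (h y) <= M ->
    enorm (A *m x - y) <= d -> edom h (A *m x) /\ fine (h (A *m x)) <= M + 1.
  move=> xr hy yM xy.
  have hyM : (h y <= M%:E)%E by rewrite (edom_fin (cs_ge0 ch y) hy) lee_fin.
  have := d1P y (A *m x) (yb _ _ xr xy) hyM (le_trans xy d_led1).
  rewrite (edom_fin (cs_ge0 ch y) hy) -EFinD => hA.
  have hAd : edom h (A *m x) by apply: (le_lt_trans hA); rewrite ltry.
  split=> //; move: hA; rewrite (edom_fin (cs_ge0 ch _) hAd) lee_fin /=.
  by move=> /le_trans; apply; rewrite lerD2r.
exists d, ry; split=> //; split.
  by rewrite /ry -addrA lerDl addr_ge0// mulr_ge0// ltW.
move=> x y fx hy fM hM xy.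
suff xr : enorm (x - xb) <= rho by split; [exact: yb xr xy | have [] := near x y xr hy hM xy].
rewrite leNgt; apply/negP => rx.
have nx0 : 0 < enorm (x - xb) by exact: lt_trans rx.
pose t := rho / enorm (x - xb).
have t0 : 0 <= t by rewrite divr_ge0 ?enorm_ge0// ltW.
have t1 : t <= 1 by rewrite ler_pdivrMr// mul1r ltW.
have t01 : 0 <= t <= 1 by rewrite t0.
(* [x] is moved towards [xb] and [y] towards [A *m xb] with the same [t], so the gap between
   [A *m xt] and [yt] only shrinks. *)
have [fxt fxtM] := convex_sublevel cf t01 fx fxb fM fbM.
have [hyt hytM] := convex_sublevel ch t01 hy hxb hM hbM.
set xt := t *: x + _ in fxt fxtM; set yt := t *: y + _ in hyt hytM.
have xtE : xt - xb = t *: (x - xb).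
  by rewrite /xt scalerBl scale1r scalerBr -addrA [xb - _ - xb]addrAC subrr sub0r.
have xtn : enorm (xt - xb) = rho.
  by rewrite xtE enormZ ger0_norm// /t divfK// gt_eqF.
have xyt : A *m xt - yt = t *: (A *m x - y).
  by rewrite /xt /yt mulmxDr -!scalemxAr opprD addrACA subrr addr0 scalerBr.
have xytd : enorm (A *m xt - yt) <= d.
  rewrite xyt enormZ ger0_norm// (le_trans _ xy)// -[leRHS]mul1r.
  by rewrite ler_wpM2r// enorm_ge0.
have xtr : enorm (xt - xb) <= rho by rewrite xtn.
have [hAx hAxM] := near xt yt xtr hyt hytM xytd.
have : r0 <= enorm xt.
  have := enormD xt (- xb); rewrite enormN xtn /rho.
  have := ler_norm r0; lra.
move=> /r0P; rewrite (edom_fin (cs_ge0 cf xt) fxt) (edom_fin (cs_ge0 ch _) hAx).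
rewrite -EFinD lee_fin; lra.
Qed.

(* The invariant bounds the augmented Lagrangian plus [by_ / 4 * |e|^2], where
   [e] is the last increment of [y] and [lam = G y + by_ *: e]; the increase
   [b * |A x' - y'|^2] caused by the multiplier update is absorbed since
   [b * (A x' - y')] is the increment of [lam], [G] is Lipschitz and
   [32 * by_ <= b]. *)
Lemma restart_invariant : exists (T : R)
    (Inv : R -> R -> 'cV[R]_n -> 'cV[R]_m -> 'cV[R]_m -> Prop),
  (forall b by_, Inv b by_ xb (A *m xb) (G (A *m xb))) /\
  forall b bx by_ x x' y y' lam, T <= b -> T <= by_ -> 32 * by_ <= b ->
    0 < by_ -> 0 <= bx -> Inv b by_ x y lam ->
    x_step f g A z b bx x y lam x' ->
    y_step f g A z b by_ x' y lam y' ->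
    Inv b by_ x' y' (lam + b *: (A *m x' - y')) /\ edom h (A *m x').
Proof.
have fb0 := fine_ge0 (cs_ge0 cf xb); have hb0 := fine_ge0 (cs_ge0 ch (A *m xb)).
have M00 : 0 <= M0 by rewrite addr_ge0.
have [d [ry [d0 [ybry regP]]]] := @near_feasible_bounded (M0 + 1) (ler_wpDr ler01 (lexx _)).
have [Lg Lg0 LgP] := grad_y_lipschitz cg g2 ry (M0 + 1) (cs_convex ch).
pose GM := enorm (G (A *m xb)) + Lg * (2 * ry).
have ry0 : 0 <= ry by apply: le_trans ybry; exact: enorm_ge0.
have hle y : edom h y -> fine (h y) <= M0 + 1 -> (g (col_mx y z) <= (M0 + 1)%:E)%E.
  by move=> hy; rewrite -lee_fin -(edom_fin (cs_ge0 ch y) hy).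
have hbM : fine (h (A *m xb)) <= M0 + 1 by rewrite /M0; lra.
have GP y : edom h y -> fine (h y) <= M0 + 1 -> enorm y <= ry -> enorm (G y) <= GM.
  move=> hy yM yr; rewrite -(subrK (G (A *m xb)) (G y)) (le_trans (enormD _ _))//.
  rewrite addrC lerD2l (le_trans (LgP y (A *m xb) yr ybry (hle y hy yM) (hle _ hxb hbM)))//.
  rewrite ler_wpM2l ?(ltW Lg0)// (le_trans (enormD _ _))// enormN; lra.
(* The summands give in turn [1 <= b], a bound on the gradient part of |lam|^2 / b, the residual
   bound [enorm r' <= d], and [Lg <= by_]. *)
exists (1 + 2 * GM ^+ 2 + 4 * (M0 + 1) / d ^+ 2 + Lg).
exists (fun b by_ x y lam => [/\ edom f x, edom h y, fine (h y) <= M0 + 1, enorm y <= ry &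
  exists e, lam = G y + by_ *: e /\ fine (f x) + fine (h y) +
    b / 2 * dotv (A *m x - y) (A *m x - y) + dotv lam (A *m x - y) +
    by_ / 4 * dotv e e <= M0]).
split.
  move=> b by_; split=> //; exists 0; split; first by rewrite scaler0 addr0.
  by rewrite subrr !dotv0r !mulr0 !addr0.
have d20 : 0 < d ^+ 2 by rewrite exprn_gt0.
have Md0 : 0 <= 4 * (M0 + 1) / d ^+ 2 by rewrite divr_ge0 ?(ltW d20)// mulr_ge0// addr_ge0.
have GM2 : 0 <= GM ^+ 2 by rewrite sqr_ge0.
move=> b bx by_ x x' y y' lam Tb Tby b32 by0 bx0 [fx hy hyM yr [e [lamE inv]]] xs ys.
have b1 : 1 <= b by lra.
have b0 : 0 < b by lra.
have bG : 2 * GM ^+ 2 <= b by lra.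
have bM : 4 * (M0 + 1) <= b * d ^+ 2 by rewrite -ler_pdivrMr//; lra.
have byL : Lg <= by_ by lra.
have fx' := x_step_edom cf ch fx hy xs.
have hy' := y_step_edom cf ch fx hy xs ys.
have dec := step_descent cf ch fx hy xs ys.
have gy := y_step_gradient cf ch fx hy xs ys.
have f0' := fine_ge0 (cs_ge0 cf x'); have h0' := fine_ge0 (cs_ge0 ch y').
set lam' := lam + b *: _ in gy *.
set r' := A *m x' - y' in dec lam' gy *.
have lamb : dotv lam lam <= 2 * GM ^+ 2 + 2 * by_ ^+ 2 * dotv e e.
  rewrite lamE (le_trans (dotv_sqr_le _ _))// -enorm_sqr dotvZl dotvZr.
  have : enorm (G y) ^+ 2 <= GM ^+ 2.
    rewrite ler_sqr ?nnegrE ?enorm_ge0 ?GP//.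
    by apply: le_trans (GP y hy hyM yr); exact: enorm_ge0.
  lra.
have e0 := dotvv_ge0 e; have t0 := dotvv_ge0 (y' - y); have s0 := dotvv_ge0 (x' - x).
have r0' := dotvv_ge0 r'.
have byb (u : R) : 0 <= u -> 32 * (by_ ^+ 2 * u) <= b * (by_ * u).
  by move=> u0; rewrite expr2 -mulrA mulrA ler_wpM2r// mulr_ge0// ltW.
(* The term in [e] is paid for by the invariant; the [1] is the slack between [M0] and the level
   [M0 + 1] used throughout. *)
have lamb' : dotv lam lam / b <= 1 + by_ / 4 * dotv e e.
  rewrite ler_pdivrMr//; have := byb _ e0.
  have : 0 <= by_ ^+ 2 * dotv e e by rewrite mulr_ge0 ?sqr_ge0.
  move: lamb bG; lra.
(* Only half of the penalty is spent against [lam]; the remaining [b / 4 * dotv r' r'] bounds the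
   residual. *)
have low := quadratic_lower_bound lam r' (divr_gt0 b0 (ltr0Sn _ 1)).
rewrite (_ : 2 * (b / 2) = b) in low; last by field.
rewrite enorm_sqr in low.
have sb : 0 <= bx / 2 * dotv (x' - x) (x' - x) by rewrite mulr_ge0// divr_ge0.
have tb : 0 <= by_ / 2 * dotv (y' - y) (y' - y) by rewrite mulr_ge0// divr_ge0// ltW.
have up : fine (f x') + fine (h y') + b / 4 * dotv r' r' <= M0 + 1 by lra.
have br0 : 0 <= b / 4 * dotv r' r' by rewrite mulr_ge0// divr_ge0// ltW.
have fM' : fine (f x') <= M0 + 1 by lra.
have hM' : fine (h y') <= M0 + 1 by lra.
have rd : enorm r' <= d.
  apply: (enorm_le (ltW d0)); rewrite -(ler_pM2l b0); lra.
have [yr' hAx'] := regP x' y' fx' hy' fM' hM' rd.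
split=> //; split=> //; exists (y' - y); split; first by rewrite -/G in gy *; rewrite gy subrK.
have uL : dotv (G y' - G y) (G y' - G y) <= by_ ^+ 2 * dotv (y' - y) (y' - y).
  rewrite -!enorm_sqr -exprMn ler_sqr ?nnegrE ?mulr_ge0 ?enorm_ge0 ?(ltW by0)//.
  apply: le_trans (LgP y' y yr' yr (hle _ hy' hM') (hle _ hy hyM)) _.
  by rewrite ler_wpM2r ?enorm_ge0.
have brE : b *: r' = (G y' - G y + by_ *: (y' - y)) - by_ *: e.
  have -> : b *: r' = lam' - lam by rewrite /lam' addrC addKr.
  have -> : lam' = G y' + by_ *: (y' - y) by rewrite [G y']gy subrK.
  by rewrite lamE opprD !addrA; congr (_ - _); rewrite addrAC.
have br2 : b * (b * dotv r' r') <=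
    8 * (by_ ^+ 2 * dotv (y' - y) (y' - y)) + 2 * (by_ ^+ 2 * dotv e e).
  rewrite -dotvZl -dotvZr brE; have := dotv_sqr_le (G y' - G y + by_ *: (y' - y)) (- (by_ *: e)).
  have := dotv_sqr_le (G y' - G y) (by_ *: (y' - y)).
  rewrite dotvNl dotvNr opprK !dotvZl !dotvZr; move: uL; lra.
(* The factor 32 turns [8 * by_ ^+ 2] into [b * by_ / 4]: this quarter and the quarter in the new
   invariant exactly use up the proximal [by_ / 2]. *)
have br3 : b * dotv r' r' <= by_ / 4 * dotv (y' - y) (y' - y) + by_ / 16 * dotv e e.
  rewrite -(ler_pM2l b0); have := byb _ e0; have := byb _ t0; move: br2; lra.
have lr : dotv lam' r' = dotv lam r' + b * dotv r' r' by rewrite /lam' dotvDl dotvZl.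
rewrite lr; have be0 : 0 <= by_ * dotv e e by rewrite mulr_ge0// ltW.
move: dec inv br3 sb be0; lra.
Qed.

End Restart.

(** * The iteration *)

Section AlgorithmInvariant.
Context {R : realType} {n m l : nat}.
Context {f : 'cV[R]_n -> \bar R} {g : 'cV[R]_(m + l) -> \bar R}.
Context {A : 'M[R]_(m, n)} {Z : set 'cV[R]_l} {x0 : 'cV[R]_n} {z0 : 'cV[R]_l}.
Hypothesis hyp : standing_assumption f g A Z x0 z0.
Hypothesis f_convex : econvex f.

Lemma f_convex_smooth : convex_smooth f.
Proof.
split=> // [||x e fx e0]; [exact: f_ge0 hyp | exact: f_cont hyp |].
exact: frechet_remainder (f_diff hyp fx) e0.
Qed.

Lemma g_convex_smooth z : convex_smooth (fun y => g (col_mx y z)).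
Proof.
by apply: partial_convex_smooth; [exact: g_ge0 hyp | exact: g_cont hyp
  | exact: g_C2 hyp | exact: (g_convex hyp)].
Qed.

Lemma objective_coercive z : coercive (fun x => f x + g (col_mx (A *m x) z))%E.
Proof.
move=> M; have [r rP] := obj_coercive hyp M; exists r => x rx.
have := rP (col_mx x z); rewrite /objective col_mxKu col_mxKd; apply.
exact: le_trans rx (enorm_col_mxl _ _).
Qed.

Lemma objective_fin x z : (objective f g A x z < +oo)%E ->
  [/\ edom f x, edom g (col_mx (A *m x) z) &
   objective f g A x z = (fine (f x) + fine (g (col_mx (A *m x) z)))%:E].
Proof.
move=> h; have fx : edom f x by apply: le_lt_trans h; rewrite leeDl// (g_ge0 hyp).
have gx : edom g (col_mx (A *m x) z) by apply: le_lt_trans h; rewrite leeDr// (f_ge0 hyp).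
split=> //; rewrite /objective {1}(edom_fin (f_ge0 hyp x) fx).
by rewrite {1}(edom_fin (g_ge0 hyp _) gx).
Qed.

Lemma edom_objective x z : edom f x -> edom g (col_mx (A *m x) z) ->
  (objective f g A x z < +oo)%E.
Proof. by move=> fx gx; rewrite /objective lte_add_pinfty. Qed.

Lemma z_step_argmin b x' y' lam z' : edom f x' ->
  is_argmin Z (fun z => aug_lagrangian f g A b x' y' z lam) z' <->
  z_argmin g Z y' z'.
Proof.
move=> fx; pose c := fine (f x') + (b / 2 * enorm (A *m x' - y') ^+ 2 + dotv lam (A *m x' - y')).
have E z : aug_lagrangian f g A b x' y' z lam = (g (col_mx y' z) + c%:E)%E.
  rewrite /aug_lagrangian (edom_fin (f_ge0 hyp x') fx) [(_ + g _)%E]addeC -!addeA.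
  by rewrite -EFinD.
split=> -[Zz zmin]; split=> // w Zw; have := zmin w Zw; rewrite !E.
  by rewrite leeD2rE.
by move=> h; apply: leeD.
Qed.

Variables (eps kappa kappay gamma eta : R).
Hypotheses (kappay_gt1 : 1 < kappay) (kappa_gt : kappay < kappa).
Hypotheses (gamma_itv : 0 < gamma < 1) (eta_itv : 0 < eta < 1).

(* When [A = 0] the proximal weight of the x-step vanishes; existence then rests
   on the coercivity of [f] alone. *)
Lemma beta_x_facts betay beta : 0 < betay -> 0 < beta ->
  0 <= beta_x A gamma betay beta /\
  (beta_x A gamma betay beta = 0 -> forall v : 'cV[R]_n, A *m v = 0).
Proof.
move=> by0 b0; have /andP[ga0 ga1] := gamma_itv.
have e1 : 0 < (eps_x gamma betay beta)^-1 - 1.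
  rewrite /eps_x invf_div.
  have -> : (betay + beta * gamma) / (betay * gamma) - 1 = (1 - gamma) / gamma + beta / betay.
    by field; rewrite !gt_eqF.
  by rewrite addr_gt0 ?divr_gt0// subr_gt0.
split; first by rewrite /beta_x divr_ge0 ?(ltW ga0)// !mulr_ge0 ?opnorm_ge0 ?ltW.
rewrite /beta_x => /eqP; rewrite !mulf_eq0 invr_eq0.
rewrite (gt_eqF b0) (gt_eqF e1) (gt_eqF ga0) /= orbF => /eqP.
exact: opnorm_gram_eq0.
Qed.

(** [good_x] and [good_y] make the current iterate a comparison point of finite value for the next
    subproblems. *)
Record good (s : state R n m l) : Prop := Good {
  good_z : st_z s = st_zbest s ;
  good_Z : Z (st_zbest s) ;
  good_x : edom f (st_x s) ;
  good_y : edom g (col_mx (st_y s) (st_zbest s)) ;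
  good_best : (objective f g A (st_xbest s) (st_zbest s) < +oo)%E ;
  good_betay : 0 < st_betay s ;
  good_beta : 0 < st_beta s }.

Lemma good_init betay beta : 0 < betay -> 0 < beta ->
  good (bcadmm_init g A Z x0 betay beta).
Proof.
move=> by0 b0; have [fx0 gx0 _] := objective_fin (start_feasible hyp).
have zm := zsol_argmin (g_ge0 hyp) (z_regular hyp) (z0_in hyp) gx0.
have gz := z_argmin_edom (z0_in hyp) gx0 zm.
by split=> //=; [case: zm | exact: edom_objective].
Qed.

Section OneStep.
Variable s : state R n m l.
Hypothesis gs : good s.
Let b := st_beta s.
Let by_ := st_betay s.
Let bx := beta_x A gamma by_ b.
Let zb := st_zbest s.

Lemma subproblemsP x' y' z' : subproblems f g A Z gamma s x' y' z' ->
  [/\ x_step f g A zb b bx (st_x s) (st_y s) (st_lam s) x',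
      y_step f g A zb b by_ x' (st_y s) (st_lam s) y',
      edom f x', edom g (col_mx y' zb) &
      z_argmin g Z y' z'].
Proof.
rewrite /subproblems (good_z gs) => -[xs ys zs].
have cf := f_convex_smooth; have ch := g_convex_smooth zb.
have fx := x_step_edom cf ch (good_x gs) (good_y gs) xs.
have gy := y_step_edom cf ch (good_x gs) (good_y gs) xs ys.
by split=> //; apply/(z_step_argmin b y' (st_lam s) z' fx).
Qed.

Lemma bcadmm_step_exists : exists o, bcadmm_step f g A Z eps kappa kappay gamma eta s o.
Proof.
have cf := f_convex_smooth; have ch := g_convex_smooth zb.
have [bx0 bxA] := beta_x_facts (good_betay gs) (good_beta gs).
have cof : coercive f \/ 0 < bx.
  have [bxp|bxn] := ltP 0 bx; [by right | left].
  (* With [A = 0] the objective at fixed z is [f] plus a finite constant, so its coercivity passes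
     to [f]. *)
  have A0 : forall v : 'cV[R]_n, A *m v = 0 by apply: bxA; apply/eqP; rewrite eq_le bxn.
  have [_ gb _] := objective_fin (good_best gs).
  move=> M; have [r rP] := objective_coercive zb (M + fine (g (col_mx (0 : 'cV[R]_m) zb))).
  exists r => v /rP; rewrite A0 EFinD.
  have g0 : g (col_mx (0 : 'cV[R]_m) zb) \is a fin_num.
    by move: gb; rewrite A0 => gb; rewrite (edom_fin (g_ge0 hyp _) gb).
  by rewrite fineK// leeD2rE.
have [x' xs] := x_step_exists cf ch (st_x s) (st_lam s) (good_beta gs) bx0 (good_y gs) cof bxA.
have [y' ys] := y_step_exists cf ch (good_beta gs) (good_betay gs) (good_x gs) (good_y gs) xs.
have fx := x_step_edom cf ch (good_x gs) (good_y gs) xs.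
have gy := y_step_edom cf ch (good_x gs) (good_y gs) xs ys.
have zm := zsol_argmin (g_ge0 hyp) (z_regular hyp) (good_Z gs) gy.
have sub : subproblems f g A Z gamma s x' y' (zsol g Z y').
  rewrite /subproblems (good_z gs); split=> //.
  by apply/(z_step_argmin b y' (st_lam s) (zsol g Z y') fx).
have [le|gt] := pselect (residual f g A x' y' (zsol g Z y') <= eps).
  by exists (Return x' y' (zsol g Z y')); exact: step_return.
by eexists; apply: step_continue sub gt.
Qed.

(** The distance to the normal cone is 0: [z] minimizes exactly over [Z], so [- grad_z] is a regular
    normal, and constant sequences make it a limiting one. *)
Lemma returned_stationary x y z :
  bcadmm_step f g A Z eps kappa kappay gamma eta s (Return x y z) -> 0 < eps ->
  eps_stationary f g A Z eps x y z.
Proof.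
move=> st e0; inversion st as [x' y' z' sub res|]; subst.
have [xs ys fx gy zm] := subproblemsP sub.
have gz := z_argmin_edom (good_Z gs) gy zm.
move: res; rewrite /residual ge_max => /andP[r1 r2].
have [Zz zmin] := zm.
split=> //; apply: (@le_trans _ _ 0%E); last by rewrite lee_fin ltW.
apply: ereal_inf_lbound; exists (- grad_z g y z); last by rewrite subrr enorm0.
have nrm := grad_z_regular_normal (g_ge0 hyp) (g_cont hyp) (g_C2 hyp) gz Zz zmin.
split=> //; exists (fun=> z), (fun=> - grad_z g y z); split=> //; exact: cvg_cst.
Qed.

Variables (x' : 'cV[R]_n) (y' : 'cV[R]_m) (z' : 'cV[R]_l).
Hypothesis sub : subproblems f g A Z gamma s x' y' z'.

Definition accepted : bool :=
  (objective f g A x' z' <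
    objective f g A (st_xbest s) (st_zbest s) +
     (1 - eta)%R%:E * (g (col_mx y' z') - g (col_mx y' (st_zbest s))))%E
  && (residual f g A x' y' (st_z s) <= eta ^+ st_K s).

(** An accepted pair has a finite objective, so the safeguard can act only after a refusal, when
    [st_z s] has been kept. *)
Definition was_reset : bool :=
  ~~ accepted && (objective f g A x' (st_z s) == +oo%E).

Lemma accepted_decrease : accepted ->
  [/\ (objective f g A x' z' < +oo)%E, residual f g A x' y' zb <= eta ^+ st_K s &
   fine (objective f g A x' z') + (1 - eta) *
     (fine (g (col_mx y' zb)) - fine (g (col_mx y' z')))
     <= fine (objective f g A (st_xbest s) zb)].
Proof.
have [xs ys fx gy zm] := subproblemsP sub.
have gz := z_argmin_edom (good_Z gs) gy zm.
move=> /andP[lo1]; rewrite (good_z gs) => th.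
have ofin : (objective f g A x' z' < +oo)%E by rewrite (lt_le_trans lo1)// leey.
split=> //; move: lo1.
have [_ _ E1] := objective_fin ofin; have [_ _ E2] := objective_fin (good_best gs).
rewrite (edom_fin (g_ge0 hyp _) gy) (edom_fin (g_ge0 hyp _) gz) -EFinB -EFinM.
rewrite [objective _ _ _ x' z']E1 [objective _ _ _ (st_xbest s) zb]E2.
rewrite -EFinD lte_fin /= => /ltW; lra.
Qed.

Let s' := advance f g A kappa kappay eta s x' y' z'.

Lemma advance_accepted : accepted -> s' =
  State x' y' z' (st_lam s + b *: (A *m x' - y')) x' z' (st_K s).+1 by_ b.
Proof.
move=> acc; have [ofin _ _] := accepted_decrease acc.
by rewrite /s' /advance -/accepted acc lt_eqF.
Qed.

Lemma advance_reset : was_reset -> s' =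
  State (st_xbest s) (A *m st_xbest s) zb (grad_y g (A *m st_xbest s) zb)
    (st_xbest s) zb (st_K s) (kappay * by_) (kappa * b).
Proof.
by move=> /andP[/negbTE na /eqP o]; rewrite /s' /advance -/accepted na o eqxx.
Qed.

Lemma advance_plain : ~~ accepted -> ~~ was_reset -> s' =
  State x' y' zb (st_lam s + b *: (A *m x' - y')) (st_xbest s) zb (st_K s) by_ b.
Proof.
rewrite /was_reset => na; rewrite na /= => /negbTE o.
by rewrite /s' /advance -/accepted (negbTE na) o (good_z gs).
Qed.

Lemma good_advance : good s'.
Proof.
have [xs ys fx gy zm] := subproblemsP sub.
have gz := z_argmin_edom (good_Z gs) gy zm.
have [acc|na] := boolP accepted.
  have [ofin _ _] := accepted_decrease acc; rewrite (advance_accepted acc).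
  by split=> //=; [case: zm | exact: good_betay gs | exact: good_beta gs].
have [rs|nr] := boolP was_reset.
  have [fb gb _] := objective_fin (good_best gs).
  rewrite (advance_reset rs); split=> //=; [exact: good_Z gs | exact: good_best gs | |].
    by rewrite mulr_gt0 ?(good_betay gs)// (lt_trans ltr01).
  by rewrite mulr_gt0 ?(good_beta gs)// (lt_trans ltr01)// (lt_trans kappay_gt1).
rewrite (advance_plain na nr); split=> //=;
  [exact: good_Z gs | exact: good_best gs | exact: good_betay gs | exact: good_beta gs].
Qed.

End OneStep.
End AlgorithmInvariant.

Arguments good {R n m l} f g A Z s.
Arguments accepted {R n m l} f g A eta s x' y' z'.
Arguments was_reset {R n m l} f g A eta s x' y' z'.

(** * Infinite runs *)

Section RealSequences.
Context {R : realType}.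

Lemma nonincreasing_from (u : nat -> R) N :
  (forall k, (N <= k)%N -> u k.+1 <= u k) ->
  forall j k, (N <= j)%N -> (j <= k)%N -> u k <= u j.
Proof.
move=> du j k Nj; elim: k => [|k IH]; first by rewrite leqn0 => /eqP ->.
rewrite leq_eqVlt => /predU1P[->//|]; rewrite ltnS => jk.
exact: le_trans (du k (leq_trans Nj jk)) (IH jk).
Qed.

(** Otherwise each of the infinitely many indices in [P] costs more than [e] and [u] becomes
    negative. [P] is acceptance in one use and trivial in the other. *)
Lemma small_decrease (u : nat -> R) (P : nat -> Prop) N e : 0 < e ->
  (forall k, (N <= k)%N -> u k.+1 <= u k) -> (forall k, (N <= k)%N -> 0 <= u k) ->
  (forall j, exists k, (j <= k)%N /\ P k) ->
  exists k, [/\ (N <= k)%N, P k & u k - u k.+1 <= e].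
Proof.
move=> e0 du u0 Pinf; apply: contrapT => nex.
have drop j : exists k, (N <= k)%N /\ u k <= u N - j%:R * e.
  elim: j => [|j [k [Nk kj]]]; first by exists N; rewrite mul0r subr0.
  have [i [ki Pi]] := Pinf k; have Ni := leq_trans Nk ki.
  exists i.+1; split; first exact: leqW.
  have : u i <= u k by exact: (nonincreasing_from du).
  have : e < u i - u i.+1.
    by rewrite ltNge; apply/negP => h; apply: nex; exists i.
  by rewrite -natr1 mulrDl mul1r; lra.
have [k [Nk]] := drop (Num.bound (u N / e)).
have : u N < (Num.bound (u N / e))%:R * e.
  by rewrite -ltr_pdivrMr// archi_boundP// divr_ge0 ?u0// ltW.
have := u0 k Nk; lra.
Qed.

(** Linear growth suffices: each index in [P] adds at least [(q - 1) * u N]. *)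
Lemma geometric_growth (u : nat -> R) (P : nat -> Prop) N (q T : R) : 1 < q ->
  0 < u N -> (forall k, (N <= k)%N -> u k <= u k.+1) ->
  (forall k, (N <= k)%N -> P k -> q * u k <= u k.+1) ->
  (forall j, exists k, (j <= k)%N /\ P k) ->
  exists k, (N <= k)%N /\ forall j, (k <= j)%N -> T <= u j.
Proof.
move=> q1 uN0 du Pq Pinf.
have mono j k : (N <= j)%N -> (j <= k)%N -> u j <= u k.
  move=> Nj jk; rewrite -lerN2; apply: (@nonincreasing_from (fun k => - u k) N) => //.
  by move=> i Ni; rewrite lerN2 du.
have c0 : 0 < (q - 1) * u N by rewrite mulr_gt0// subr_gt0.
have grow j : exists k, (N <= k)%N /\ j%:R * ((q - 1) * u N) <= u k.
  elim: j => [|j [k [Nk kj]]]; first by exists N; rewrite mul0r ltW.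
  have [i [ki Pi]] := Pinf k; have Ni := leq_trans Nk ki.
  exists i.+1; split; first exact: leqW.
  have := Pq i Ni Pi; have := mono _ _ Nk ki; have := mono _ _ (leqnn N) Ni.
  move=> h1 h2 h3; have : (q - 1) * u N <= (q - 1) * u i.
    by rewrite ler_wpM2l// subr_ge0 ltW.
  by rewrite -natr1 (mulrDl j%:R) mul1r; lra.
have [k [Nk kT]] := grow (Num.bound (`|T| / ((q - 1) * u N))).
exists k; split=> // j kj; apply: le_trans (mono k j Nk kj); apply: le_trans kT.
rewrite (le_trans (ler_norm T))// -ler_pdivrMr// ltW// archi_boundP//.
by rewrite divr_ge0// ltW.
Qed.

Lemma power_small (eta d : R) : 0 < eta < 1 -> 0 < d ->
  exists j, forall k, (j <= k)%N -> eta ^+ k <= d.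
Proof.
move=> /andP[e0 e1] d0.
have c0 : eta ^+ k @[k --> \oo] --> (0 : R).
  by apply: cvg_expr; rewrite ger0_norm// ltW.
have [j _ jP] : \forall k \near \oo, `|eta ^+ k| <= d by exact: cvgr0_norm_le.
by exists j => k /jP /=; apply: le_trans; exact: ler_norm.
Qed.

End RealSequences.

(** * The three cases of an infinite run *)

Section Runs.
Context {R : realType} {n m l : nat}.
Context {f : 'cV[R]_n -> \bar R} {g : 'cV[R]_(m + l) -> \bar R}.
Context {A : 'M[R]_(m, n)} {Z : set 'cV[R]_l} {x0 : 'cV[R]_n} {z0 : 'cV[R]_l}.
Hypothesis hyp : standing_assumption f g A Z x0 z0.
Hypothesis f_convex : econvex f.
Context {eps kappa kappay gamma eta : R}.
Hypothesis eps_gt0 : 0 < eps.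
Hypotheses (kappay_gt1 : 1 < kappay) (kappa_gt : kappay < kappa).
Hypotheses (gamma_itv : 0 < gamma < 1) (eta_itv : 0 < eta < 1).
Variables (s : nat -> state R n m l) (X : nat -> 'cV[R]_n) (Y : nat -> 'cV[R]_m)
  (W : nat -> 'cV[R]_l).
Hypothesis good_s : forall k, good f g A Z (s k).
Hypothesis sub : forall k, subproblems f g A Z gamma (s k) (X k) (Y k) (W k).
Hypothesis unfinished : forall k, ~ (residual f g A (X k) (Y k) (W k) <= eps).
Hypothesis next : forall k, s k.+1 = advance f g A kappa kappay eta (s k) (X k) (Y k) (W k).

Let acc k := accepted f g A eta (s k) (X k) (Y k) (W k).
Let rst k := was_reset f g A eta (s k) (X k) (Y k) (W k).
Let zb k := st_zbest (s k).
Let xb k := st_xbest (s k).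
Let Phi k := fine (objective f g A (xb k) (zb k)).

(** Passes from Theta, computed with the old z, to the termination test, computed with the new
    one. *)
Lemma residual_switch (e d aT : R) x y w w' :
  (forall v : 'cV[R]_m, enorm (A^T *m v) <= aT * enorm v) ->
  residual f g A x y w <= e ->
  aT * enorm (grad_y g y w' - grad_y g y w) <= d ->
  residual f g A x y w' <= e + d.
Proof.
move=> AT; rewrite /residual !ge_max => /andP[r1 r2] ATd.
have d0 : 0 <= d.
  by apply: le_trans ATd; apply: le_trans (AT _); exact: enorm_ge0.
apply/andP; split; last by rewrite (le_trans r2)// lerDl.
have -> : grad_f f x + A^T *m grad_y g y w' = (grad_f f x + A^T *m grad_y g y w)
    + A^T *m (grad_y g y w' - grad_y g y w).
  by rewrite mulmxBr -addrA; congr (_ + _); rewrite [RHS]addrC subrK.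
rewrite (le_trans (ler_normD _ _))// lerD//.
by rewrite (le_trans (norm_le_enorm _))// (le_trans (AT _)).
Qed.

Lemma Phi_nonincreasing k : Phi k.+1 <= Phi k.
Proof.
have gs := good_s k; have [xs ys fx gy zm] := subproblemsP hyp f_convex gs (sub k).
have gz := z_argmin_edom (good_Z gs) gy zm.
rewrite /Phi /xb /zb next; have [ac|na] := boolP (acc k).
  rewrite (advance_accepted hyp f_convex kappa kappay gs (sub k) ac) /=.
  have [_ _] := accepted_decrease hyp f_convex gs (sub k) ac.
  apply: le_trans; rewrite lerDl mulr_ge0//.
    by have /andP[_ e1] := eta_itv; rewrite subr_ge0 ltW.
  rewrite subr_ge0; have [_ /(_ _ (good_Z gs))] := zm.
  by rewrite (edom_fin (g_ge0 hyp _) gy) (edom_fin (g_ge0 hyp _) gz) lee_fin.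
have [rs|nr] := boolP (rst k).
  by rewrite (advance_reset kappa kappay rs).
by rewrite (advance_plain kappa kappay gs na nr).
Qed.

Lemma Phi_ge0 k : 0 <= Phi k.
Proof. by rewrite fine_ge0// adde_ge0 ?(f_ge0 hyp)// (g_ge0 hyp). Qed.

Lemma Phi_le0 k : Phi k <= Phi 0.
Proof. by apply: (@nonincreasing_from _ Phi 0) => // j _; exact: Phi_nonincreasing. Qed.

Lemma best_bounded : exists r, 0 <= r /\ forall k, enorm (xb k) <= r /\ enorm (zb k) <= r.
Proof.
have [r rP] := obj_coercive hyp (Phi 0 + 1); exists `|r|; split=> // k.
have [_ _ E] := objective_fin hyp (good_best (good_s k)).
have cr : enorm (col_mx (xb k) (zb k)) <= `|r|.
  rewrite (le_trans _ (ler_norm r))// leNgt; apply/negP => /ltW/rP.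
  rewrite col_mxKu col_mxKd E lee_fin.
  have := Phi_le0 k; rewrite {1}/Phi E /=; lra.
by split; apply: le_trans cr; [exact: enorm_col_mxl | exact: enorm_col_mxr].
Qed.

Lemma K_unbounded : (forall j, exists k, (j <= k)%N /\ acc k) ->
  forall j, exists N, forall k, (N <= k)%N -> (j <= st_K (s k))%N.
Proof.
move=> inf_acc.
have step k : st_K (s k.+1) = (st_K (s k) + acc k)%N.
  rewrite next; have [ac|na] := boolP (acc k).
    by rewrite (advance_accepted hyp f_convex kappa kappay (good_s k) (sub k) ac) addn1.
  rewrite addn0; have [rs|nr] := boolP (rst k).
    by rewrite (advance_reset kappa kappay rs).
  by rewrite (advance_plain kappa kappay (good_s k) na nr).
have mono j k : (j <= k)%N -> (st_K (s j) <= st_K (s k))%N.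
  elim: k => [|k IH]; first by rewrite leqn0 => /eqP ->.
  rewrite leq_eqVlt => /predU1P[->//|]; rewrite ltnS => /IH jk.
  by rewrite step (leq_trans jk)// leq_addr.
elim=> [|j [N NP]]; first by exists 0%N.
have [k [Nk ak]] := inf_acc N; exists k.+1 => i ki.
by apply: leq_trans (mono _ _ ki); rewrite step ak addn1 ltnS NP.
Qed.

Lemma finitely_many_accepts : ~ (forall j, exists k, (j <= k)%N /\ acc k).
Proof.
move=> inf_acc.
have /andP[eta0 eta1] := eta_itv.
have [r [r0 rP]] := best_bounded.
have [a a0 Aa] := mulmx_bound A; have [aT aT0 AT] := mulmx_bound A^T.
pose rY := a * r + 1.
have rY0 : 0 <= rY by rewrite addr_ge0// mulr_ge0// ltW.
have [d1 d10 d1P] := usc_near_sublevel (rY + r) (Phi 0) (g_ge0 hyp) (g_cont hyp) ltr01.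
have e20 : 0 < eps / 2 / aT by rewrite !divr_gt0.
have [d3 d30 d3P] := grad_y_near_argmin (g_ge0 hyp) (g_cont hyp) (g_C2 hyp)
  (Z_closed hyp) (z_regular hyp) (rY + r) (Phi 0 + 2) e20.
pose d := Num.min (eps / 2) (Num.min 1 d1 / m.+1%:R).
have d0 : 0 < d by rewrite lt_min !divr_gt0// lt_min ltr01.
have [j jP] := power_small eta_itv d0.
have [N NP] := K_unbounded inf_acc j.
(* A gap of at most [d3] makes the gradients close; a gap of at most 1 keeps [g] at [(Y k, zb k)]
   below the level [Phi 0 + 2] for which [d3] was chosen. *)
have g0 : 0 < (1 - eta) * Num.min d3 1 by rewrite mulr_gt0 ?subr_gt0// lt_min d30 ltr01.
have [k [Nk ak kdec]] := small_decrease g0 (N := N) (fun k _ => Phi_nonincreasing k)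
  (fun k _ => Phi_ge0 k) inf_acc.
have gs := good_s k; have [xs ys fx gy zm] := subproblemsP hyp f_convex gs (sub k).
have gz := z_argmin_edom (good_Z gs) gy zm.
have [ofin th dec] := accepted_decrease hyp f_convex gs (sub k) ak.
have snext := advance_accepted hyp f_convex kappa kappay gs (sub k) ak.
rewrite -next in snext.
have [xr zr] := rP k.+1; rewrite /xb /zb snext /= in xr zr.
have [_ wr] := rP k.
have Phik : Phi k.+1 = fine (objective f g A (X k) (W k)) by rewrite /Phi /xb /zb snext.
have [fX gX oE] := objective_fin hyp ofin.
have thd : residual f g A (X k) (Y k) (zb k) <= d.
  by apply: (le_trans th); apply: jP; exact: NP.
have xyd : enorm (Y k - A *m X k) <= Num.min 1 d1.
  rewrite enormB (le_trans (enorm_le_norm _))//.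
  have : `|A *m X k - Y k| <= Num.min 1 d1 / m.+1%:R.
    move: thd; rewrite /residual ge_max => /andP[_ /le_trans]; apply.
    by rewrite ge_min lexx orbT.
  move=> /(ler_wpM2l (ler0n R m)) /le_trans; apply.
  by rewrite mulrCA ger_pMr ?lt_min ?ltr01// ler_pdivrMr// mul1r ler_nat.
have AXr : enorm (A *m X k) <= a * r by rewrite (le_trans (Aa _))// ler_wpM2l// ltW.
have Yr : enorm (Y k) <= rY.
  rewrite -(subrK (A *m X k) (Y k)) (le_trans (enormD _ _))// addrC lerD//.
  by rewrite (le_trans xyd)// ge_min lexx.
have oPhi : fine (f (X k)) + fine (g (col_mx (A *m X k) (W k))) <= Phi 0.
  by have := Phi_le0 k.+1; rewrite Phik oE.
have fX0 := fine_ge0 (f_ge0 hyp (X k)).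
(* Acceptance bounds [g] at [A *m X k], whereas the gap is taken at [Y k]; [d1] carries the bound
   over. *)
have gYW : fine (g (col_mx (Y k) (W k))) <= Phi 0 + 1.
  have pr : enorm (col_mx (A *m X k) (W k)) <= rY + r.
    by rewrite (le_trans (enorm_col_mx_le _ _))// lerD// (le_trans AXr)// lerDl.
  have pM : (g (col_mx (A *m X k) (W k)) <= (Phi 0)%:E)%E.
    by rewrite (edom_fin (g_ge0 hyp _) gX) lee_fin; lra.
  have pq : enorm (col_mx (Y k) (W k) - col_mx (A *m X k) (W k)) <= d1.
    rewrite opp_col_mx add_col_mx subrr (le_trans (enorm_col_mx_le _ _))// enorm0 addr0.
    by rewrite (le_trans xyd)// ge_min lexx orbT.
  have := d1P _ _ pr pM pq.
  rewrite (edom_fin (g_ge0 hyp _) gX) (edom_fin (g_ge0 hyp _) gz) -EFinD lee_fin; lra.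
have gap : fine (g (col_mx (Y k) (zb k))) - fine (g (col_mx (Y k) (W k))) <= Num.min d3 1.
  rewrite -(ler_pM2l (_ : 0 < 1 - eta)) ?subr_gt0//; apply: le_trans kdec.
  by rewrite Phik; move: dec; rewrite /Phi /xb /zb; lra.
have gap1 : fine (g (col_mx (Y k) (zb k))) - fine (g (col_mx (Y k) (W k))) <= 1.
  by rewrite (le_trans gap)// ge_min lexx orbT.
have gap3 : fine (g (col_mx (Y k) (zb k))) - fine (g (col_mx (Y k) (W k))) <= d3.
  by rewrite (le_trans gap)// ge_min lexx.
have grd : enorm (grad_y g (Y k) (W k) - grad_y g (Y k) (zb k)) <= eps / 2 / aT.
  apply: d3P => //.
  - by rewrite (le_trans Yr)// lerDl.
  - by rewrite (le_trans zr)// lerDr.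
  - by rewrite (le_trans wr)// lerDr.
  - exact: good_Z gs.
  - by rewrite (edom_fin (g_ge0 hyp _) gy) lee_fin; lra.
  - rewrite (edom_fin (g_ge0 hyp _) gy) (edom_fin (g_ge0 hyp _) gz) -EFinD lee_fin; lra.
apply: (@unfinished k); rewrite [eps]splitr.
apply: (residual_switch AT (w := zb k)).
  by rewrite (le_trans thd)// ge_min lexx.
by rewrite mulrC -ler_pdivlMr.
Qed.

Lemma frozen_best N : (forall k, (N <= k)%N -> ~~ acc k) ->
  forall k, (N <= k)%N -> xb k = xb N /\ zb k = zb N.
Proof.
move=> na; elim=> [|k IH]; first by rewrite leqn0 => /eqP ->.
rewrite leq_eqVlt => /predU1P[->//|]; rewrite ltnS => Nk.
have [<- <-] := IH Nk; rewrite /xb /zb next.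
have [rs|nr] := boolP (rst k); first by rewrite (advance_reset kappa kappay rs).
by rewrite (advance_plain kappa kappay (good_s k) (na k Nk) nr).
Qed.

Lemma finitely_many_resets N : (forall k, (N <= k)%N -> ~~ acc k) ->
  ~ (forall j, exists k, (j <= k)%N /\ rst k).
Proof.
move=> na inf_rst; have frz := frozen_best na.
have [fxb gxb _] := objective_fin hyp (good_best (good_s N)).
have cf := f_convex_smooth hyp f_convex; have ch := g_convex_smooth hyp (zb N).
have [T [Inv [Inv0 InvS]]] := restart_invariant cf ch (g_cont hyp) (g_C2 hyp)
  (objective_coercive hyp (zb N)) fxb gxb.
have ky0 : 0 < kappay by rewrite (lt_trans ltr01).
have k0 : 0 < kappa by rewrite (lt_trans ky0).
(* Each reset multiplies the ratio by [kappa / kappay > 1], which eventually secures the factor 32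
   of the invariant. *)
pose ratio k := st_beta (s k) / st_betay (s k).
have rst_eq k : rst k -> st_betay (s k.+1) = kappay * st_betay (s k) /\
    ratio k.+1 = kappa / kappay * ratio k.
  move=> rs; rewrite /ratio next (advance_reset kappa kappay rs) /=; split=> //.
  by field; rewrite !gt_eqF// (good_betay (good_s k)).
have plain_eq k : (N <= k)%N -> ~~ rst k -> st_betay (s k.+1) = st_betay (s k) /\
    st_beta (s k.+1) = st_beta (s k).
  by move=> Nk nr; rewrite next (advance_plain kappa kappay (good_s k) (na k Nk) nr).
have by0 k := good_betay (good_s k); have b0 k := good_beta (good_s k).
have ra0 k : 0 < ratio k by rewrite divr_gt0.
have q1 : 1 < kappa / kappay by rewrite ltr_pdivlMr// mul1r.
have [k1 [Nk1 k1P]] : exists k, (N <= k)%N /\ forall j, (k <= j)%N -> T <= st_betay (s j).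
  apply: (geometric_growth (u := fun k => st_betay (s k)) T kappay_gt1 (by0 N) _ _ inf_rst) => k Nk.
    have [/rst_eq[-> _]|/(plain_eq k Nk)[-> _]//] := boolP (rst k).
    by rewrite ler_peMl ?(ltW (by0 k))// ltW.
  by move=> /rst_eq[-> _].
have [k2 [Nk2 k2P]] : exists k, (N <= k)%N /\ forall j, (k <= j)%N -> 32 <= ratio j.
  apply: (geometric_growth (u := ratio) 32 q1 (ra0 N) _ _ inf_rst) => k Nk.
    have [/rst_eq[_ ->]|/(plain_eq k Nk)[E1 E2]] := boolP (rst k).
      by rewrite ler_peMl ?(ltW (ra0 k))// ltW.
    by rewrite /ratio E1 E2.
  by move=> /rst_eq[_ ->].
(* This reset, made with large enough penalties, starts the invariant at [k.+1]; from there no reset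
   is possible. *)
have [k [kk rk]] := inf_rst (maxn k1 k2).
move: kk; rewrite geq_max => /andP[k1k k2k].
have Nk := leq_trans Nk1 k1k.
pose J j := Inv (st_beta (s j)) (st_betay (s j)) (st_x (s j)) (st_y (s j)) (st_lam (s j)).
have tail j : (k.+1 <= j)%N -> J j -> ~~ rst j /\ J j.+1.
  move=> kj Jj; have Nj : (N <= j)%N by rewrite (leq_trans Nk)// ltnW.
  have gs := good_s j; have [xs ys fx gy _] := subproblemsP hyp f_convex gs (sub j).
  have zE : st_zbest (s j) = zb N by have [_] := frz j Nj.
  rewrite zE in xs ys.
  have Tby : T <= st_betay (s j) by apply: k1P; rewrite (leq_trans k1k)// ltnW.
  have b32 : 32 * st_betay (s j) <= st_beta (s j).
    by rewrite -ler_pdivlMr//; apply: k2P; rewrite (leq_trans k2k)// ltnW.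
  have Tb : T <= st_beta (s j) by have := by0 j; lra.
  have [bx0 _] := beta_x_facts (A := A) gamma_itv (by0 j) (b0 j).
  have [Inv' hA] := InvS _ _ _ _ _ _ _ _ Tb Tby b32 (by0 j) bx0 Jj xs ys.
  have nr : ~~ rst j.
    rewrite /rst /was_reset negb_and; apply/orP; right.
    by rewrite (good_z gs) zE lt_eqF// (edom_objective fx).
  split=> //; rewrite /J next (advance_plain kappa kappay gs (na j Nj) nr) /=.
  exact: Inv'.
have Jall j : (k.+1 <= j)%N -> J j.
  elim: j => // j IH; rewrite leq_eqVlt => /predU1P[[<-]|]; last first.
    by rewrite ltnS => kj; have [] := tail j kj (IH kj).
  rewrite /J next (advance_reset kappa kappay rk) /=.
  by have [xE zE] := frz k Nk; rewrite -/(xb k) -/(zb k) xE zE; exact: Inv0.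
have [i [ki ri]] := inf_rst k.+1.
by have [/negP] := tail i ki (Jall i ki).
Qed.

Lemma no_quiet_tail N : ~ (forall k, (N <= k)%N -> ~~ acc k /\ ~~ rst k).
Proof.
move=> quiet; have na k Nk := (quiet k Nk).1; have frz := frozen_best na.
have /andP[eta0 eta1] := eta_itv.
have cf := f_convex_smooth hyp f_convex; have ch := g_convex_smooth hyp (zb N).
have [fxb gxb oE] := objective_fin hyp (good_best (good_s N)).
have snext k : (N <= k)%N -> s k.+1 = State (X k) (Y k) (zb N)
    (st_lam (s k) + st_beta (s k) *: (A *m X k - Y k)) (xb N) (zb N) (st_K (s k))
    (st_betay (s k)) (st_beta (s k)).
  move=> Nk; have [xE zE] := frz k Nk; have [nk rk] := quiet k Nk.
  rewrite next (advance_plain kappa kappay (good_s k) nk rk).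
  by rewrite -/(xb k) -/(zb k) xE zE.
pose b := st_beta (s N); pose by_ := st_betay (s N); pose K := st_K (s N).
have cst k : (N <= k)%N -> [/\ st_beta (s k) = b, st_betay (s k) = by_ & st_K (s k) = K].
  elim: k => [|k IH]; first by rewrite leqn0 /b /by_ /K => /eqP ->.
  by rewrite leq_eqVlt => /predU1P[<-//|]; rewrite ltnS => Nk; rewrite snext //=; exact: IH.
have b0 : 0 < b := good_beta (good_s N); have by0 : 0 < by_ := good_betay (good_s N).
have [bx0 _] := beta_x_facts (A := A) gamma_itv by0 b0.
set bx := beta_x A gamma by_ b in bx0.
have steps k : (N <= k)%N ->
    [/\ x_step f g A (zb N) b bx (st_x (s k)) (st_y (s k))
          (st_lam (s k)) (X k),
        y_step f g A (zb N) b by_ (X k) (st_y (s k))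
          (st_lam (s k)) (Y k),
        edom f (X k), edom g (col_mx (Y k) (zb N)) &
        z_argmin g Z (Y k) (W k)].
  move=> Nk; have := subproblemsP hyp f_convex (good_s k) (sub k).
  have [_ zE] := frz k Nk; have [-> -> _] := cst k Nk.
  by rewrite -/(zb k) zE.
have gyk k : (N <= k)%N -> edom (fun y => g (col_mx y (zb N))) (st_y (s k)).
  by move=> Nk; have := good_y (good_s k); rewrite -/(zb k); have [_ ->] := frz k Nk.
have [xo [fxo gxo kkt]] := kkt_point cf ch (objective_coercive hyp (zb N))
  (ex_intro _ (xb N) (conj fxb gxb)).
pose V k := saddle_lyapunov g A (zb N) xo b bx by_
  (st_x (s k)) (st_y (s k)) (st_lam (s k)).
have Vdec k : (N <= k)%N -> V k.+1 <= V k.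
  move=> Nk; have [xs ys _ _ _] := steps k Nk.
  have := saddle_lyapunov_decrease cf ch fxo gxo kkt b0 (good_x (good_s k)) (gyk k Nk) xs ys.
  have [bE _ _] := cst k Nk.
  rewrite /V snext //= bE; apply: le_trans.
  have h1 := mulr_ge0 (ltW by0) (dotvv_ge0 (Y k - st_y (s k))).
  have h2 := mulr_ge0 bx0 (dotvv_ge0 (X k - st_x (s k))).
  have h3 := mulr_ge0 (ltW b0) (dotvv_ge0 (A *m X k - st_y (s k))).
  by move: h1 h2 h3; set v := saddle_lyapunov _ _ _ _ _ _ _ _ _ _; lra.
have V0 k : (N <= k)%N -> 0 <= V k by move=> _; apply: saddle_lyapunov_ge0.
have [aT aT0 AT] := mulmx_bound A^T.
pose rY := enorm (A *m xo) + (1 + V N / (b + by_)).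
have rY0 : 0 <= rY by rewrite !addr_ge0 ?enorm_ge0// divr_ge0 ?V0// addr_ge0// ltW.
have [rb rbP] := z_argmin_bounded (g_ge0 hyp) (z_regular hyp) (rY + enorm (zb N)) (Phi N + 1).
have e20 : 0 < eps / 2 / aT by rewrite !divr_gt0.
have [d3 d30 d3P] := grad_y_near_argmin (g_ge0 hyp) (g_cont hyp) (g_C2 hyp)
  (Z_closed hyp) (z_regular hyp) (rY + enorm (zb N) + `|rb|) (Phi N + 1) e20.
(* The refused update will give eta * gap <= [e + e2], and [e <= e2] turns this into gap <= [d3]. *)
pose e2 := eta * d3 / 2.
have e2p : 0 < e2 by rewrite divr_gt0// mulr_gt0.
have [d1 d10 d1P] := usc_near_sublevel (rY + `|rb|) (Phi N + 1) (g_ge0 hyp) (g_cont hyp) e2p.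
pose e := Num.min (Num.min (eps / 2) (eta ^+ K)) (Num.min e2 (Num.min d1 1)).
have e0 : 0 < e by rewrite !lt_min divr_gt0 ?exprn_gt0 ?e2p ?d10 ?ltr01.
have ee : [/\ e <= eps / 2, e <= eta ^+ K, e <= e2, e <= d1 & e <= 1].
  by split; rewrite !ge_min lexx ?orbT.
have [d d0 dP] := saddle_phase cf ch fxo gxo kkt b0 bx0 by0 fxb gxb (V0 N (leqnn N)) e0.
have [k [Nk _ kd]] := small_decrease (P := fun=> True) d0 Vdec V0
  (fun j => ex_intro _ j (conj (leqnn j) I)).
have [xs ys fX gY zm] := steps k Nk; have [bE _ KE] := cst k Nk.
have [ee1 ee2 ee3 ee4 ee5] := ee.
have VN : V k <= V N by exact: (nonincreasing_from Vdec).
have VN1 : V k.+1 <= V N by exact: le_trans (Vdec k Nk) VN.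
have := kd; rewrite [V k.+1]/V snext //= bE => kd'.
have [p1 p2 p3] := dP _ _ _ _ _ (good_x (good_s k)) (gyk k Nk) xs ys VN kd'.
have Yr : enorm (Y k) <= rY.
  have := saddle_lyapunov_boundy b0 bx0 by0 VN1; by rewrite snext.
have gW := z_argmin_edom (good_Z (good_s N)) gY zm.
have gWz : fine (g (col_mx (Y k) (W k))) <= fine (g (col_mx (Y k) (zb N))).
  have [_ /(_ _ (good_Z (good_s N)))] := zm.
  by rewrite -/(zb N) (edom_fin (g_ge0 hyp _) gW) (edom_fin (g_ge0 hyp _) gY) lee_fin.
have PhiE : Phi N = fine (f (xb N)) + fine (g (col_mx (A *m xb N) (zb N))).
  by rewrite /Phi oE.
have fX0 := fine_ge0 (f_ge0 hyp (X k)).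
have gYM : fine (g (col_mx (Y k) (zb N))) <= Phi N + 1.
  by move: p3; rewrite -PhiE; lra.
have gYM' : (g (col_mx (Y k) (zb N)) <= (Phi N + 1)%:E)%E.
  by rewrite (edom_fin (g_ge0 hyp _) gY) lee_fin.
have Wr : enorm (W k) <= `|rb|.
  rewrite (le_trans _ (ler_norm rb))//; apply: rbP gYM' (good_Z (good_s N)) zm.
    by rewrite (le_trans Yr)// lerDl enorm_ge0.
  by rewrite lerDr.
have res : residual f g A (X k) (Y k) (zb N) <= e.
  rewrite /residual ge_max; apply/andP; split; exact: le_trans (norm_le_enorm _) _.
have pr : enorm (col_mx (Y k) (W k)) <= rY + `|rb|.
  by rewrite (le_trans (enorm_col_mx_le _ _))// lerD.
have pM : (g (col_mx (Y k) (W k)) <= (Phi N + 1)%:E)%E.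
  by rewrite (edom_fin (g_ge0 hyp _) gW) lee_fin; exact: le_trans gWz gYM.
(* The update test evaluates [g] at [A *m X k], where finiteness with [W k] has to be inferred from
   the nearby [Y k]. *)
have pq : enorm (col_mx (A *m X k) (W k) - col_mx (Y k) (W k)) <= d1.
  rewrite opp_col_mx add_col_mx subrr (le_trans (enorm_col_mx_le _ _))// enorm0 addr0.
  exact: le_trans p2 ee4.
have := d1P _ _ pr pM pq; rewrite (edom_fin (g_ge0 hyp _) gW) -EFinD => gAX.
have gAXd : edom g (col_mx (A *m X k) (W k)) by apply: (le_lt_trans gAX); rewrite ltry.
move: gAX; rewrite (edom_fin (g_ge0 hyp _) gAXd) lee_fin /= => gAX.
have [_ zE] := frz k Nk; have [xE _] := frz k Nk.
have [nk _] := quiet k Nk.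
(* The residual passes the test against [eta ^+ K], so the refusal must come from the objective
   test; the error is [e] from near-optimality plus [e2] from replacing [Y k] by [A *m X k]. *)
have key : eta * (fine (g (col_mx (Y k) (zb N))) - fine (g (col_mx (Y k) (W k)))) <= e + e2.
  move: nk; rewrite /acc /accepted negb_and (good_z (good_s k)) -/(xb k) -/(zb k) xE zE KE.
  rewrite (le_trans res ee2) orbF -leNgt.
  have [_ _ E1] := objective_fin hyp (edom_objective fX gAXd).
  rewrite oE E1 (edom_fin (g_ge0 hyp _) gW) (edom_fin (g_ge0 hyp _) gY) -EFinB -EFinM.
  rewrite -EFinD lee_fin /=; move: p3 gAX; lra.
have gap : fine (g (col_mx (Y k) (zb N))) - fine (g (col_mx (Y k) (W k))) <= d3.
  rewrite -(ler_pM2l eta0) (le_trans key)//.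
  by move: ee3; rewrite /e2; lra.
have grd : enorm (grad_y g (Y k) (W k) - grad_y g (Y k) (zb N)) <= eps / 2 / aT.
  apply: d3P => //.
  - by rewrite (le_trans Yr)// -addrA lerDl addr_ge0 ?enorm_ge0.
  - by rewrite (le_trans Wr)// lerDr addr_ge0 ?enorm_ge0.
  - by rewrite -addrA addrCA lerDl addr_ge0.
  - exact: good_Z (good_s N).
  - rewrite (edom_fin (g_ge0 hyp _) gY) (edom_fin (g_ge0 hyp _) gW) -EFinD lee_fin; lra.
apply: (@unfinished k); rewrite [eps]splitr.
apply: (residual_switch AT (w := zb N)); first exact: le_trans res ee1.
by rewrite mulrC -ler_pdivlMr.
Qed.

Lemma run_terminates : False.
Proof.
have [inf|] := pselect (forall j, exists k, (j <= k)%N /\ acc k).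
  exact: finitely_many_accepts inf.
move=> /existsNP[N /forallNP hN].
have na k : (N <= k)%N -> ~~ acc k.
  by move=> Nk; apply/negP => ak; exact: (hN k).
have [inf|] := pselect (forall j, exists k, (j <= k)%N /\ rst k).
  exact: finitely_many_resets na inf.
move=> /existsNP[N' /forallNP hN'].
apply: (@no_quiet_tail (maxn N N')) => k; rewrite geq_max => /andP[Nk N'k].
by split; [exact: na | apply/negP => rk; exact: (hN' k)].
Qed.

End Runs.

Theorem theorem6 (R : realType) (n m l : nat)
    (f : 'cV[R]_n -> \bar R) (g : 'cV[R]_(m + l) -> \bar R)
    (A : 'M[R]_(m, n)) (Z : set 'cV[R]_l)
    (x0 : 'cV[R]_n) (z0 : 'cV[R]_l)
    (eps kappa kappay gamma eta betay beta : R)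
    (hyp : standing_assumption f g A Z x0 z0)
    (f_convex : econvex f)
    (eps_gt0 : 0 < eps)
    (kappay_gt1 : 1 < kappay) (kappa_gt : kappay < kappa)
    (gamma_itv : 0 < gamma < 1) (eta_itv : 0 < eta < 1)
    (betay_gt0 : 0 < betay) (beta_gt0 : 0 < beta) :
  let init := bcadmm_init g A Z x0 betay beta in
  let step := bcadmm_step f g A Z eps kappa kappay gamma eta in
  [/\ (* every subproblem met has a solution: the algorithm never gets stuck *)
      forall s, reachable step init s -> exists o, step s o,
      (* no run continues forever without passing the termination test *)
      forall s : nat -> state R n m l, s 0%N = init ->
        ~ (forall k, step (s k) (Continue (s k.+1)))
    & (* whatever is returned is stationary *)
      forall s x y z, reachable step init s -> step s (Return x y z) ->
        eps_stationary f g A Z eps x y z].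
Proof.
move=> init step.
have continueP s s' : step s (Continue s') -> exists t : 'cV[R]_n * 'cV[R]_m * 'cV[R]_l,
    [/\ subproblems f g A Z gamma s t.1.1 t.1.2 t.2,
        ~ (residual f g A t.1.1 t.1.2 t.2 <= eps) &
        s' = advance f g A kappa kappay eta s t.1.1 t.1.2 t.2].
  by move=> st; inversion st as [|x y z sub res E]; exists (x, y, z).
have good_step s s' : good f g A Z s -> step s (Continue s') -> good f g A Z s'.
  move=> gs /continueP[t [sub _ ->]].
  exact: (good_advance hyp f_convex eta kappay_gt1 kappa_gt gs sub).
have good0 : good f g A Z init := good_init hyp betay_gt0 beta_gt0.
have good_reach s : reachable step init s -> good f g A Z s.
  by elim=> // s1 s2 _ gs1 /(good_step _ _ gs1).
split=> [s /good_reach gs|s s0 run|s x y z /good_reach gs st].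
- exact: (bcadmm_step_exists hyp f_convex eps kappa kappay eta gamma_itv gs).
- have gs k : good f g A Z (s k).
    by elim: k => [|k IH]; [rewrite s0 | exact: good_step IH (run k)].
  have [t tP] := choice (fun k => continueP _ _ (run k)).
  by apply: (run_terminates hyp f_convex eps_gt0 kappay_gt1 kappa_gt gamma_itv eta_itv gs
    (X := fun k => (t k).1.1) (Y := fun k => (t k).1.2) (W := fun k => (t k).2)) => k;
    have [] := tP k.
- exact: (returned_stationary hyp f_convex gs st eps_gt0).
Qed.
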